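(* Let $\mathbb{F}=\mathbb{R}$ or $\mathbb{C}$, let $n\geq 2$, let $E$ be the subspace of $\mathbb{F}$-self-adjoint matrices in $\mathcal{M}_n(\mathbb{F})$ (real symmetric, respectively Hermitian, $n\times n$ matrices), and let $\overline{B_E}$ be the volume-one homothetic copy of the unit ball of the operator norm on $E$. Then $\overline{B_E}$ is not isotropic, i.e. its covariance matrix $\mathrm{Cov}(\overline{B_E})$ is not a multiple of the identity; yet $\overline{B_E}$ is in almost isotropic position, i.e. the condition number (ratio of largest to smallest eigenvalue) of $\mathrm{Cov}(\overline{B_E})$ is bounded above by an absolute constant independent of $n$.
   Context: $E$ is a real vector space of dimension $d_n$ with the Euclidean structure given by the Hilbert-Schmidt norm $(\mathrm{Tr}(TT^* ))^{1/2}$; volume and $dT$ refer to the corresponding Lebesgue measure. $B_E=\{T\in E:s_{\max}(T)\leq 1\}$, with $s_{\max}$ the largest singular value, and $\overline{B_E}=B_E/[\mathrm{vol}(B_E)]^{1/d_n}$. For a convex body $K$ in a Euclidean space with orthonormal coordinates $x_1,\dots,x_m$, the covariance matrix is $\mathrm{Cov}(K)_{i,j}=\frac{\int_K x_ix_j\,dx}{\mathrm{vol}(K)}-\frac{\int_K x_i\,dx}{\mathrm{vol}(K)}\frac{\int_K x_j\,dx}{\mathrm{vol}(K)}$. Here the orthonormal basis used consists of the matrices $J^{kk}$, $\frac{1}{\sqrt2}(J^{kl}+J^{lk})$ for $k<l$, and, when $\mathbb{F}=\mathbb{C}$, also $\frac{i}{\sqrt2}(J^{kl}-J^{lk})$ for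 $k<l$, where $J^{kl}$ has a single nonzero entry, equal to $1$, in position $(k,l)$. *)

(* Defs.v *)
From HB Require Import structures.
From mathcomp Require Import all_boot all_order all_algebra.
From mathcomp Require Import all_classical all_reals all_analysis.
From mathcomp Require Import complex.

Set Implicit Arguments.
Unset Strict Implicit.
Unset Printing Implicit Defensive.

Import Order.TTheory GRing.Theory Num.Theory.

Local Open Scope classical_set_scope.
Local Open Scope ring_scope.

(* The product of a measure on T and a measure on T^m, transported to T^(m+1)
   along (x, t) |-> x :: t. *)
Section cons_measure.
Context d (T : measurableType d) (R : realType) (m : nat).
Variables (l : {sigma_finite_measure set T -> \bar R}).
Variables (mu : {sigma_finite_measure set (m.-tuple T) -> \bar R}).

Definition tuple_cons (p : T * m.-tuple T) : m.+1.-tuple T :=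
  [tuple of p.1 :: p.2].

Definition cons_measure : set (m.+1.-tuple T) -> \bar R :=
  pushforward (l \x mu)%E tuple_cons.

Let tuple_uncons (t : m.+1.-tuple T) : T * m.-tuple T :=
  (tnth t ord0, [tuple of behead t]).

Lemma measurable_tuple_cons : measurable_fun setT tuple_cons.
Proof. exact: measurable_cons. Qed.

Let measurable_tuple_uncons : measurable_fun setT tuple_uncons.
Proof.
apply/measurable_fun_pairP; split; first exact: measurable_tnth.
exact: measurable_behead.
Qed.

Let tuple_consK : cancel tuple_cons tuple_uncons.
Proof. by move=> [x t]; congr pair; apply: val_inj. Qed.

Let cons_measure0 : cons_measure set0 = 0%E.
Proof. by rewrite /cons_measure /pushforward preimage_set0 measure0. Qed.

Let cons_measure_ge0 A : (0 <= cons_measure A)%E.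
Proof. exact: (measure_ge0 (l \x mu)%E). Qed.

Let cons_measure_sigma_additive : semi_sigma_additive cons_measure.
Proof.
exact: (@measure_semi_sigma_additive _ _ _
  (measure_function_pushforward__canonical__measure_function_Measure
    (l \x mu)%E measurable_tuple_cons)).
Qed.

HB.instance Definition _ := isMeasure.Build _ _ _ cons_measure
  cons_measure0 cons_measure_ge0 cons_measure_sigma_additive.

Let cons_measure_sigma_finite : sigma_finite setT cons_measure.
Proof.
have /sigma_finiteP[F [TF ndF Foo]] := sigma_finiteT l.
have /sigma_finiteP[G [TG ndG Goo]] := sigma_finiteT mu.
exists (fun k => tuple_uncons @^-1` (F k `*` G k)).
  apply/seteqP; split=> // t _.
  have [i _ Fi] : (\bigcup_i F i) (tuple_uncons t).1 by rewrite -TF.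
  have [j _ Gj] : (\bigcup_j G j) (tuple_uncons t).2 by rewrite -TG.
  exists (maxn i j) => //; split.
  - by move: Fi; exact/subsetPset/ndF/leq_maxl.
  - by move: Gj; exact/subsetPset/ndG/leq_maxr.
move=> k; have [mF Fk] := Foo k; have [mG Gk] := Goo k; split.
  rewrite -[X in measurable X]setTI; apply: measurable_tuple_uncons => //.
  exact: measurableX.
rewrite /cons_measure /pushforward -comp_preimage.
rewrite (_ : _ \o _ = id); last by apply/funext => p; exact: tuple_consK.
by rewrite preimage_id product_measure1E// lte_mul_pinfty// ge0_fin_numE.
Qed.

HB.instance Definition _ := Measure_isSigmaFinite.Build _ _ _ cons_measure
  cons_measure_sigma_finite.

End cons_measure.

Fixpoint lebesgue_tuple (R : realType) (m : nat) :
    {sigma_finite_measure set (m.-tuple (measurableTypeR R)) -> \bar R} :=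
  match m with
  | 0 => \d_([tuple] : 0.-tuple (measurableTypeR R))
  | m'.+1 => cons_measure (@lebesgue_measure R) (lebesgue_tuple R m')
  end.

Section covariance.
Variables (R : realType) (m : nat) (K : set (m.-tuple (measurableTypeR R))).

Definition volume : R := fine (lebesgue_tuple R m K).

Definition average (f : m.-tuple (measurableTypeR R) -> R) : R :=
  Rintegral (lebesgue_tuple R m) K f / volume.

Definition Cov : 'M[R]_m :=
  \matrix_(i, j) (average (fun x => tnth x i * tnth x j)
                  - average (fun x => tnth x i) * average (fun x => tnth x j)).

End covariance.

(* For positive semidefinite A of positive size.  The value +oo when A is
   singular rules out the junk value lmax / 0 = 0. *)
Definition condition_number (R : realType) (m : nat) (A : 'M[R]_m) : \bar R :=
  let lmax := sup [set a | eigenvalue A a] in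
  let lmin := inf [set a | eigenvalue A a] in
  if 0 < lmin then (lmax / lmin)%:E else +oo%E.

Inductive scalars := RealScalars | ComplexScalars.

Definition scalar_field (R : realType) (F : scalars) : numFieldType :=
  match F with RealScalars => R | ComplexScalars => R[i] end.

Definition of_real (R : realType) (F : scalars) : R -> scalar_field R F :=
  match F with
  | RealScalars => fun x => x
  | ComplexScalars => fun x => Complex x 0
  end.

Definition conj_scalar (R : realType) (F : scalars) :
    scalar_field R F -> scalar_field R F :=
  match F with
  | RealScalars => fun z => z
  | ComplexScalars => fun z => conjc z
  end.

(* The value over the reals is a dummy: it is used only for basis elements
   indexed by a type that is empty in that case. *)
Definition imag_unit (R : realType) (F : scalars) : scalar_field R F :=
  match F with RealScalars => 0 | ComplexScalars => Complex 0 1 end.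

Section selfadjoint.
Variables (R : realType) (F : scalars) (n : nat).
Local Notation of_real := (@of_real R F).
Local Notation imag_unit := (imag_unit R F).
Local Notation M := 'M[scalar_field R F]_n.

Definition adjoint (T : M) : M := (map_mx (@conj_scalar R F) T)^T.

Definition selfadjoint : set M := [set T | adjoint T = T].

Definition singular_values (T : M) : set R :=
  [set s | 0 <= s /\ eigenvalue (T *m adjoint T) (of_real (s ^+ 2))].

Definition s_max (T : M) : R := sup (singular_values T).

Definition ball_E : set M :=
  [set T | selfadjoint T /\ s_max T <= 1].

(* The three summands index J^{kk}, (J^{kl} + J^{lk}) / sqrt 2 and
   i (J^{kl} - J^{lk}) / sqrt 2, the last one being empty over the reals. *)
Definition basis_index : finType :=
  ('I_n + {p : 'I_n * 'I_n | (p.1 < p.2)%N}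
        + {p : 'I_n * 'I_n |
             (p.1 < p.2)%N && (if F is ComplexScalars then true else false)})%type.

Definition basis_E (b : basis_index) : M :=
  match b with
  | inl (inl k) => delta_mx k k
  | inl (inr p) => let: (k, l) := val p in
      of_real (Num.sqrt 2)^-1 *: (delta_mx k l + delta_mx l k)
  | inr p => let: (k, l) := val p in
      (imag_unit * of_real (Num.sqrt 2)^-1) *: (delta_mx k l - delta_mx l k)
  end.

Definition dim_E : nat := #|basis_index|.

(* basis_E is orthonormal for Tr (S T^* ), so of_coords is an isometry from R^dim_E
   onto E for the Hilbert-Schmidt norm and carries Lebesgue measure to that of E. *)
Definition of_coords (x : dim_E.-tuple (measurableTypeR R)) : M :=
  \sum_(b : basis_index) of_real (tnth x (enum_rank b)) *: basis_E b.

Definition volume_E (K : set M) : R := volume (of_coords @^-1` K).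

Definition Cov_E (K : set M) : 'M[R]_dim_E :=
  Cov (of_coords @^-1` K).

Definition unit_volume_ball_E : set M :=
  [set of_real (volume_E ball_E `^ (dim_E%:R)^-1)^-1 *: T | T in ball_E].

End selfadjoint.

Arguments ball_E : clear implicits.
Arguments unit_volume_ball_E : clear implicits.

(* Main.v *)
Require Import Defs.
From mathcomp Require Import all_boot all_order all_algebra.
From mathcomp Require Import all_classical all_reals all_analysis.
From mathcomp Require Import measurable_realfun sesquilinear spectral perm complex.
From mathcomp Require Import ring lra.

(** Write [T] for the generic point of the space of self-adjoint matrices,
    [B] for the ball of radius [r] and [Y = r^2 - T^2].  A vector field of the
    form [V = Y W + W' Y], with [W'] the adjoint of [W], is tangent to the
    boundary of [B]: if [T v = r v] or [T v = - r v], then [<V v, v> = 0].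
    Hence the integral over [B] of [V f + f div V] vanishes for every
    polynomial [f] and every polynomial [W] for which [V] takes its values in
    the space ([divergence_ball]).

    Three families of fields suffice: [W = A] constant with [f = 1] or with [f]
    a coordinate, and [W = A T] with [f = 1].  They give linear relations
    between the moments of [B] of degree at most two ([mean_constant],
    [moment_constant], [moment_linear]).  The relations close up because
    divergences are sums over an orthonormal basis [S_b] that satisfies
      [sum_b (S_b)_ip (S_b)_qj = c1 [i = j][p = q] + c2 [i = q][p = j]]
    with [c1 = 1], [c2 = 0] over the complex numbers and [c1 = c2 = 1/2] over
    the reals ([cbasis_complete]).  Solving them gives the covariance matrix
    exactly ([Cov_opball]): for some [a > 0] it is
      [a (2 (c1 n + c2) - c1 tau tau^T)],  [tau_b = tr S_b],  [|tau|^2 = n].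
    The entry at the positions of [J^11] and [J^22] is [- a c1], so the matrix
    is not scalar.  Its eigenvalues are [2 a (c1 n + c2)], on the traceless
    matrices, and [a (c1 n + 2 c2)], on the multiples of the identity.  Their
    ratio is [2] over the complex numbers and [2 (n + 1) / (n + 2)] over the
    reals, so that [2] is a bound that does not depend on [n].

    To prove [divergence_ball] without boundary integrals, the field is
    multiplied by [1 - (1 - D)^(2k)], where [D = det Y / r^(2n)].  The product
    vanishes on the boundary, and along each coordinate axis the ball is cut in
    a segment whose ends lie on the boundary, so that the fundamental theorem
    of calculus and the Fubini theorem apply ([integral_partial0]).  The
    derivative of [D] along [V] is [- D tr (TW + WT + TW' + W'T)]
    ([derive_det_field]), hence the contribution of the cutoff tends to [0] by
    dominated convergence ([cutoff_limit]), the boundary being a null set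
    because the volume is homogeneous ([opball_boundary_null]).

    Real symmetric matrices are treated inside the complex Hermitian ones, so
    that one spectral theorem serves both cases. *)

Set Implicit Arguments.
Unset Strict Implicit.
Unset Printing Implicit Defensive.

Import Order.TTheory GRing.Theory Num.Theory.
Import numFieldNormedType.Exports.

Local Open Scope classical_set_scope.
Local Open Scope ring_scope.

(** * Lebesgue measure on tuples *)

Section lebesgue_tuple_theory.
Context {R : realType}.
Local Notation tup m := (m.-tuple (measurableTypeR R)).
Local Notation leb m := (lebesgue_tuple R m).

Definition cube m (L : R) : set (tup m) := [set x | forall i, `|tnth x i| <= L].

Definition set_coord m (x : tup m) (i : 'I_m) (t : R) : tup m :=
  [tuple if j == i then t else tnth x j | j < m].

Definition tcons m (t : R) (x : tup m) : tup m.+1 := [tuple of t :: x].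

Lemma tnth_set_coord m (x : tup m) i t j :
  tnth (set_coord x i t) j = if j == i then t else tnth x j.
Proof. by rewrite tnth_mktuple. Qed.

Lemma set_coord_tcons0 m (x : tup m) s t :
  set_coord (tcons s x) ord0 t = tcons t x.
Proof.
apply: eq_from_tnth => j; rewrite tnth_set_coord.
by case: (unliftP ord0 j) => [k ->|->]; rewrite ?eqxx// eq_sym (negbTE (neq_lift _ _)) !tnthS.
Qed.

Lemma set_coord_tconsS m (x : tup m) s t (i : 'I_m) :
  set_coord (tcons s x) (lift ord0 i) t = tcons s (set_coord x i t).
Proof.
apply: eq_from_tnth => j; rewrite tnth_set_coord.
case: (unliftP ord0 j) => [k ->|->]; first by rewrite (inj_eq lift_inj) !tnthS tnth_set_coord.
by rewrite (negbTE (neq_lift _ _)).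
Qed.

Lemma cubeS m L : tuple_cons (T := measurableTypeR R) (m := m) @^-1` cube L = `[-L, L]%classic `*` cube L.
Proof.
apply/seteqP; split => -[t x] /=.
  move=> H; split; first by have := H ord0; rewrite ler_norml in_itv.
  by move=> i; have := H (lift ord0 i); rewrite tnthS.
move=> [H1 H2] i; case: (unliftP ord0 i) => [k ->|->]; first by rewrite tnthS; exact: H2.
by rewrite ler_norml; move: H1; rewrite in_itv.
Qed.

Lemma measurable_cube m L : measurable (cube L : set (tup m)).
Proof.
rewrite (_ : cube L = \bigcap_(i in [set: 'I_m]) (@tnth m R ^~ i) @^-1` `[-L, L]%classic).
  apply: fin_bigcap_measurable => // i _; rewrite -[X in measurable X]setTI.
  exact: measurable_tnth.
apply/seteqP; split => x /= H i; first by move=> _; rewrite /= in_itv /= -ler_norml.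
by have := H i I; rewrite /= in_itv /= -ler_norml.
Qed.

Lemma lebesgue_cube m L : 0 <= L -> leb m (cube L) = ((2 * L) ^+ m)%:E.
Proof.
move=> L0; elim: m => [|m IH] /=.
  by rewrite expr0 diracE mem_set // => i; case: i.
rewrite /cons_measure /pushforward cubeS product_measure1E//; last exact: measurable_cube.
rewrite [X in (X * _)%E](_ : _ = (2 * L)%:E) ?IH ?exprS ?EFinM //.
transitivity (lebesgue_measure `[- L, L]%classic); first by [].
rewrite lebesgue_measure_itv /= lte_fin; case: ltP => L0'; first by rewrite -EFinB opprK; congr EFin; ring.
by congr EFin; lra.
Qed.

Definition bounded_support m (f : tup m -> R) :=
  exists M L, [/\ 0 <= L, forall x, `|f x| <= M & forall x, f x != 0 -> cube L x].

Lemma bounded_support_tcons m (f : tup m.+1 -> R) t :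
  bounded_support f -> bounded_support (f \o tcons t).
Proof.
move=> [M [L [L0 fM fL]]]; exists M, L; split => //= x /fL H i.
by have := H (lift ord0 i); rewrite tnthS.
Qed.

Lemma integrable_bounded_support m (f : tup m -> R) :
  measurable_fun setT f -> bounded_support f -> (leb m).-integrable setT (EFin \o f).
Proof.
move=> mf [M [L [L0 fM fL]]].
have -> : EFin \o f = ((EFin \o f) \_ (cube L)).
  apply/funext => x; rewrite patchE; case: ifPn => // /negP xL.
  have [/= ->//|fx] := eqVneq (f x) 0.
  by exfalso; apply: xL; rewrite inE; exact: fL.
rewrite -integrable_mkcond; last exact: measurable_cube.
apply: measurable_bounded_integrable; first exact: measurable_cube.
- by rewrite [X in (X < _)%E](lebesgue_cube m L0) ltry.
- exact: measurable_funS mf.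
- by exists M; split; [exact: num_real|move=> x Mx z _; apply: le_trans (fM z) (ltW Mx)].
Qed.

(** By induction on the dimension: either [i] is the first coordinate, which is
    integrated first, or the inner integral over the other coordinates already
    vanishes.  Bounded support makes every slice integrable, so that no
    exceptional set of slices has to be discarded. *)
Lemma integral_coord0 m (f : tup m -> R) (i : 'I_m) :
    measurable_fun setT f -> bounded_support f ->
    (forall x, \int[lebesgue_measure]_t (f (set_coord x i t))%:E = 0)%E ->
  (\int[leb m]_x (f x)%:E = 0)%E.
Proof.
elim: m f i => [f []//|m IH f i mf bf fi0].
have mcons := @measurable_tuple_cons _ (measurableTypeR R) m.
have /= intf := integrable_bounded_support mf bf.
have mfE : measurable_fun (setT : set (tup m.+1)) (fun x => (f x)%:E) by exact/measurable_EFinP.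
have intc : ((@lebesgue_measure R) \x (leb m))%E.-integrable setT
   ((EFin \o f) \o tuple_cons (m := m)).
  move/integrableP : intf => [_ fioo]; apply/integrableP; split.
    exact: measurableT_comp.
  move: fioo => /=; rewrite /cons_measure (ge0_integral_pushforward mcons) //.
  by apply/measurable_EFinP; exact: measurableT_comp.
have mtc t : measurable_fun setT (@tcons m t).
  apply: (@measurable_cons _ _ _ _ (fun=> t) m id) => //.
rewrite [LHS](@integral_pushforward _ _ _ _ _ _ mcons _ setT) //=.
case: (unliftP ord0 i) => [j ij|i0].
  rewrite -integral12_prod_meas1 //= integral0_eq // => t _.
  apply: (IH (f \o tcons t) j); first exact: measurableT_comp.
    exact: bounded_support_tcons.
  move=> x; rewrite -[RHS](fi0 (tcons t x)); apply: eq_integral => s _ /=.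
  by rewrite ij set_coord_tconsS.
rewrite -integral21_prod_meas1 //= integral0_eq // => x _.
rewrite -[RHS](fi0 (tcons 0 x)); apply: eq_integral => s _ /=.
by rewrite i0 set_coord_tcons0.
Qed.

End lebesgue_tuple_theory.

Section scaling.
Context {R : realType}.
Local Notation tup m := (m.-tuple (measurableTypeR R)).
Local Notation leb m := (lebesgue_tuple R m).

(** Lebesgue measure is determined by its values on intervals. *)
Lemma lebesgue_measure_scale (c : R) (A : set R) : 0 < c -> measurable A ->
  (lebesgue_measure (( *%R c : _ -> measurableTypeR R) @^-1` A) = (c^-1)%:E * lebesgue_measure A)%E.
Proof.
move=> c0 mA.
have mc : measurable_fun setT ( *%R c : measurableTypeR R -> measurableTypeR R).
  exact: mulrl_measurable.
have c0' : 0 <= c by exact: ltW.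
pose nu := mscale (NngNum c0') (measure_function_pushforward__canonical__measure_function_Measure
    (@lebesgue_measure R) mc).
have -> : lebesgue_measure A = nu A.
  apply: lebesgue_measure_unique => // _ [[a b] /= ab <-].
  rewrite /nu /mscale /= /pushforward.
  rewrite (_ : _ @^-1` _ = `]c^-1 * a, c^-1 * b]%classic); last first.
    apply/seteqP; split => x /=; rewrite !in_itv /= => /andP[h1 h2]; apply/andP; split.
    + by rewrite mulrC ltr_pdivrMr // mulrC.
    + by rewrite mulrC ler_pdivlMr // mulrC.
    + by move: h1; rewrite mulrC ltr_pdivrMr // mulrC.
    + by move: h2; rewrite mulrC ler_pdivlMr // mulrC.
  rewrite !lebesgue_measure_itv /= !lte_fin ltr_pM2l ?invr_gt0 //.
  case: ifP => _; last by rewrite mule0.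
  by rewrite -!EFinD -EFinM; congr EFin; field; rewrite gt_eqF.
by rewrite /nu /mscale /= /pushforward muleA -EFinM mulVf ?gt_eqF // mul1e.
Qed.

Definition scale_tuple m (c : R) (x : tup m) : tup m := [tuple c * tnth x i | i < m].

Lemma scale_tuple_tcons m c t (x : tup m) : scale_tuple c (tcons t x) = tcons (c * t) (scale_tuple c x).
Proof.
apply: eq_from_tnth => j; rewrite tnth_mktuple.
case: (unliftP ord0 j) => [k ->|-> //].
by rewrite !tnthS tnth_mktuple.
Qed.

(** Homogeneity of the volume, from dimension one and the Fubini theorem. *)
Lemma lebesgue_scale m (c : R) (A : set (tup m)) : 0 < c -> measurable A ->
  (leb m (scale_tuple c @^-1` A) = (c ^- m)%:E * leb m A)%E.
Proof.
move=> c0; elim: m A => [|m IH] A mA.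
  rewrite /= !diracE expr0 invr1 mul1e; congr (_ %:R)%:E; congr (nat_of_bool _).
  by apply/idP/idP; rewrite !inE /=; congr A; apply: eq_from_tnth => -[].
have mcons := @measurable_tuple_cons _ (measurableTypeR R) m.
pose B := tuple_cons (T := measurableTypeR R) (m := m) @^-1` A.
have mB : measurable B by rewrite -[B]setTI; exact: mcons.
pose h x := leb m (xsection B x).
have mh : measurable_fun setT h by exact: measurable_fun_xsection.
have mc : measurable_fun setT ( *%R c : measurableTypeR R -> measurableTypeR R).
  exact: mulrl_measurable.
have c0' : 0 <= c^-1 by rewrite invr_ge0 ltW.
have -> : leb m.+1 A = (\int[lebesgue_measure]_x h x)%E by [].
transitivity (\int[lebesgue_measure]_x ((c ^- m)%:E * h ((c * (x : R))%R : measurableTypeR R)))%E.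
  rewrite /= /cons_measure /pushforward /product_measure1.
  apply: eq_integral => x _ /=; rewrite /h.
  rewrite -IH; last exact: measurable_xsection.
  congr (lebesgue_tuple _ _ _); apply/seteqP.
  by split => y; rewrite /xsection /= !inE /B /= scale_tuple_tcons.
rewrite ge0_integralZl //; last 2 first.
- exact: (measurableT_comp mh mc).
- by rewrite lee_fin invr_ge0 exprn_ge0 // ltW.
have := @ge0_integral_pushforward _ _ _ _ R _ mc lebesgue_measure setT h measurableT mh.
rewrite preimage_setT => <-; last by move=> x _; exact: measure_ge0.
rewrite (eq_measure_integral (mscale (NngNum c0') lebesgue_measure)); last first.
  by move=> X mX _; rewrite /= /pushforward lebesgue_measure_scale.
rewrite ge0_integral_mscale //= muleA -EFinM; congr (_%:E * _)%E.
by rewrite exprS invfM mulrC.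
Qed.
End scaling.

(** * Polynomial functions and integration by slices *)

Section polynomial_functions.
Context {R : realType} {m : nat}.
Local Notation tup := (m.-tuple (measurableTypeR R)).
Local Notation leb := (lebesgue_tuple R m).

(** Polynomial functions of the coordinates, each given with its partial
    derivatives.  An inductive presentation yields measurability, boundedness
    on cubes and differentiability at once. *)
Inductive poly_fun : (tup -> R) -> ('I_m -> tup -> R) -> Prop :=
| PolyCst c : poly_fun (fun=> c) (fun _ _ => 0)
| PolyCoord j : poly_fun (fun x => tnth x j) (fun i _ => (i == j)%:R)
| PolyAdd f df g dg : poly_fun f df -> poly_fun g dg ->
    poly_fun (fun x => f x + g x) (fun i x => df i x + dg i x)
| PolyMul f df g dg : poly_fun f df -> poly_fun g dg ->
    poly_fun (fun x => f x * g x) (fun i x => df i x * g x + f x * dg i x).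

Lemma poly_fun_partial f df i : poly_fun f df -> exists ddf, poly_fun (df i) ddf.
Proof.
elim=> {f df} [c|j|f df g dg _ [d1 p1] _ [d2 p2]|f df g dg pf [d1 p1] pg [d2 p2]].
- by eexists; exact: PolyCst.
- by eexists; exact: PolyCst.
- by eexists; exact: PolyAdd p1 p2.
- by eexists; apply: PolyAdd; apply: PolyMul; eassumption.
Qed.

Lemma poly_fun_measurable f df : poly_fun f df -> measurable_fun setT f.
Proof.
elim=> {f df} [c|j|f df g dg _ m1 _ m2|f df g dg _ m1 _ m2].
- exact: measurable_cst.
- exact: measurable_tnth.
- exact: measurable_funD.
- exact: measurable_funM.
Qed.

Lemma poly_fun_bounded L f df : poly_fun f df ->
  exists M, forall x, cube L x -> `|f x| <= M.
Proof.
elim=> {f df} [c|j|f df g dg _ [M1 b1] _ [M2 b2]|f df g dg _ [M1 b1] _ [M2 b2]].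
- by exists `|c|.
- by exists L => x; apply.
- exists (M1 + M2) => x xL; apply: le_trans (ler_normD _ _) _.
  by rewrite lerD ?b1 ?b2.
- by exists (M1 * M2) => x xL; rewrite normrM ler_pM ?b1 ?b2.
Qed.

Lemma poly_fun_derive f df (x : tup) i (t : R) : poly_fun f df ->
  is_derive t (1 : R) (fun s : R => f (set_coord x i s)) (df i (set_coord x i t)).
Proof.
elim=> {f df} [c|j|f df g dg _ d1 _ d2|f df g dg _ d1 _ d2].
- exact: is_derive_cst.
- under eq_fun do rewrite tnth_set_coord eq_sym.
  case: eqP => _; first exact: is_derive_id.
  exact: is_derive_cst.
- exact: is_deriveD.
rewrite [X in is_derive _ _ X](_ : _ = (fun s : R => f (set_coord x i s)) * (fun s : R => g (set_coord x i s))) //.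
have H := is_deriveM d1 d2; apply: (is_derive_eq H).
  by rewrite /GRing.scale /= addrC [X in X + _]mulrC.
Qed.

Lemma poly_fun_continuous f df (x : tup) i : poly_fun f df ->
  continuous (fun s : R => f (set_coord x i s)).
Proof.
move=> pf t; apply: differentiable_continuous; apply/derivable1_diffP.
by have [] := poly_fun_derive x i t pf.
Qed.

(** The fundamental theorem of calculus. *)
Lemma integral_derive0 f df (x : tup) i a b : poly_fun f df -> a <= b ->
    f (set_coord x i a) = 0 -> f (set_coord x i b) = 0 ->
  (\int[lebesgue_measure]_(t in `[a, b]) (df i (set_coord x i t))%:E = 0)%E.
Proof.
move=> pf; rewrite le_eqVlt => /predU1P[<- _ _|ab fa fb].
  by rewrite set_itv1 integral_set1.
have [ddf pdf] := poly_fun_partial i pf.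
pose F (s : R) := f (set_coord x i s).
have cF : continuous F by exact: poly_fun_continuous pf.
rewrite (@continuous_FTC2 _ (fun s : R => df i (set_coord x i s)) F) //.
- by rewrite /F fa fb subee.
- by apply: continuous_subspaceT; exact: (poly_fun_continuous pdf).
- split=> [t _| |].
  + by have [] := poly_fun_derive x i t pf.
  + by apply: cvg_at_right_filter; exact: cF.
  + by apply: cvg_at_left_filter; exact: cF.
- by move=> t _; rewrite derive1E; have := poly_fun_derive x i t pf => /@derive_val.
Qed.

Variables (K : set tup) (L : R).
Hypotheses (L0 : 0 <= L) (mK : measurable K) (KL : K `<=` cube L).

Lemma poly_fun_bounded_support f df : poly_fun f df -> bounded_support (f \_ K).
Proof.
move=> pf; have [M fM] := poly_fun_bounded L pf.
exists (Num.max M 0), L; split => // x; rewrite patchE; case: ifPn => [xK|_].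
- by rewrite le_max fM //; apply: KL; rewrite inE in xK.
- by rewrite normr0 le_max lexx orbT.
- by move=> _; apply: KL; rewrite inE in xK.
- by rewrite eqxx.
Qed.

Lemma poly_fun_restrict_measurable f df : poly_fun f df -> measurable_fun setT (f \_ K).
Proof.
move=> pf; apply/(measurable_restrictT f mK).
by apply: measurable_funS (poly_fun_measurable pf).
Qed.

Lemma poly_fun_integrable f df : poly_fun f df -> leb.-integrable K (EFin \o f).
Proof.
move=> pf; apply/integrable_mkcond => //.
rewrite (restrict_EFin f K); apply: integrable_bounded_support.
- exact: poly_fun_restrict_measurable pf.
- exact: poly_fun_bounded_support pf.
Qed.

(** If [f] vanishes at both ends of every segment that [K] cuts on a line parallel
    to the [i]-th axis, the inner integral of its partial derivative is zero on
    each line.  This replaces an integration over the boundary of [K]. *)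
Lemma integral_partial0 f df i : poly_fun f df ->
    (forall x, (set_coord x i @^-1` K = set0) \/
       exists a b, [/\ a <= b, set_coord x i @^-1` K = `[a, b]%classic,
          f (set_coord x i a) = 0 & f (set_coord x i b) = 0]) ->
  \int[leb]_(x in K) df i x = 0.
Proof.
move=> pf Hs; have [ddf pdf] := poly_fun_partial i pf.
rewrite Rintegral_mkcond /Rintegral.
rewrite (@integral_coord0 _ m (df i \_ K) i) //.
- exact: poly_fun_restrict_measurable pdf.
- exact: poly_fun_bounded_support pdf.
move=> x.
transitivity (\int[lebesgue_measure]_(t in set_coord x i @^-1` K) (df i (set_coord x i t))%:E)%E.
  rewrite [RHS]integral_mkcond; apply: eq_integral => t _.
  rewrite !patchE /=; have -> : (t \in set_coord x i @^-1` K) = (set_coord x i t \in K).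
    by apply/idP/idP; rewrite !inE.
  by case: ifP.
have [->|[a [b [ab -> fa fb]]]] := Hs x; first by rewrite integral_set0.
exact: integral_derive0 pf ab fa fb.
Qed.

End polynomial_functions.

(** * Complex and matrix valued polynomial functions *)

(** The left-hand side differentiates the Leibniz formula of the determinant of [A] in the
    direction [B]; grouping the terms by the row that is differentiated gives
    row expansions of determinants whose cofactors are those of [A]. *)
Lemma trace_adj_mul (K : comNzRingType) n (A B : 'M[K]_n) :
  \sum_(s : 'S_n) (-1) ^+ s * (\sum_i B i (s i) * \prod_(j | j != i) A j (s j)) =
  \tr (\adj A *m B).
Proof.
under eq_bigr => s _ do rewrite mulr_sumr.
rewrite exchange_big /= mxtrace_mulC /mxtrace; apply: eq_bigr => i _.
pose A' := \matrix_(k, l) (if k == i then B k l else A k l).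
transitivity (\det A').
  apply: eq_bigr => s _; congr (_ * _).
  rewrite [RHS](bigD1 i) //= mxE eqxx; congr (_ * _).
  by apply: eq_bigr => j /negbTE ji; rewrite mxE ji.
rewrite (expand_det_row _ i) mxE; apply: eq_bigr => j _.
rewrite !mxE eqxx; congr (_ * _); rewrite /cofactor; congr (_ * _).
congr (\det _); apply/matrixP => k l; rewrite !mxE.
by rewrite eq_sym (negbTE (neq_lift _ _)).
Qed.

Section complex_poly.
Context {R : realType} {m : nat}.
Local Notation tup := (m.-tuple (measurableTypeR R)).
Local Notation C := R[i].
Local Notation Re := (@complex.Re R).
Local Notation Im := (@complex.Im R).

Lemma poly_fun_eq (f g : tup -> R) df dg : poly_fun f df -> f =1 g ->
  (forall i, df i =1 dg i) -> poly_fun g dg.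
Proof.
move=> pf /funext <- H; suff <- : df = dg by [].
by apply/funext => i; apply/funext => x; exact: H.
Qed.

(** Complex valued functions of real variables, with derivatives taken on real
    and imaginary parts. *)
Definition cpoly (f : tup -> C) (df : 'I_m -> tup -> C) :=
  poly_fun (fun x => Re (f x)) (fun i x => Re (df i x)) /\
  poly_fun (fun x => Im (f x)) (fun i x => Im (df i x)).

Lemma cpoly_eq f g df dg : cpoly f df -> f =1 g ->
  (forall i, df i =1 dg i) -> cpoly g dg.
Proof.
move=> pf /funext <- H; suff <- : df = dg by [].
by apply/funext => i; apply/funext => x; exact: H.
Qed.

Lemma cpoly_cst c : cpoly (fun=> c) (fun _ _ => 0).
Proof. by split; exact: PolyCst. Qed.

Lemma cpoly_coord j : cpoly (fun x => (tnth x j)%:C%C) (fun i _ => (i == j)%:R).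
Proof.
split; first by apply: poly_fun_eq (PolyCoord j) _ _ => // i x; case: eqP.
by apply: poly_fun_eq (PolyCst 0) _ _ => // i x; case: eqP.
Qed.

Lemma cpolyD f df g dg : cpoly f df -> cpoly g dg ->
  cpoly (fun x => f x + g x) (fun i x => df i x + dg i x).
Proof.
move=> [f1 f2] [g1 g2]; split.
- apply: poly_fun_eq (PolyAdd f1 g1) _ _ => [x|i x] /=.
    by case: (f x) (g x) => ? ? [].
  by case: (df i x) (dg i x) => ? ? [].
- apply: poly_fun_eq (PolyAdd f2 g2) _ _ => [x|i x] /=.
    by case: (f x) (g x) => ? ? [].
  by case: (df i x) (dg i x) => ? ? [].
Qed.

Lemma cpolyM f df g dg : cpoly f df -> cpoly g dg ->
  cpoly (fun x => f x * g x) (fun i x => df i x * g x + f x * dg i x).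
Proof.
move=> [f1 f2] [g1 g2]; split.
- apply: poly_fun_eq (PolyAdd (PolyMul f1 g1)
    (PolyMul (PolyCst (-1)) (PolyMul f2 g2))) _ _ => [x|i x] /=.
    by case: (f x) (g x) => ? ? [? ?] /=; ring.
  by case: (f x) (g x) (df i x) (dg i x) => ? ? [? ?] [? ?] [? ?] /=; ring.
- apply: poly_fun_eq (PolyAdd (PolyMul f1 g2) (PolyMul f2 g1)) _ _ => [x|i x] /=.
    by case: (f x) (g x) => ? ? [? ?] /=; ring.
  by case: (f x) (g x) (df i x) (dg i x) => ? ? [? ?] [? ?] [? ?] /=; ring.
Qed.

Lemma cpolyN f df : cpoly f df -> cpoly (fun x => - f x) (fun i x => - df i x).
Proof.
move=> pf; apply: cpoly_eq (cpolyM (cpoly_cst (-1)) pf) _ _ => [x|i x] /=.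
  by rewrite mulN1r.
by rewrite mul0r add0r mulN1r.
Qed.

Lemma cpolyB f df g dg : cpoly f df -> cpoly g dg ->
  cpoly (fun x => f x - g x) (fun i x => df i x - dg i x).
Proof. by move=> pf pg; exact: cpolyD pf (cpolyN pg). Qed.

Lemma cpolyZ c f df : cpoly f df -> cpoly (fun x => c * f x) (fun i x => c * df i x).
Proof.
move=> pf; apply: cpoly_eq (cpolyM (cpoly_cst c) pf) _ _ => // i x.
by rewrite mul0r add0r.
Qed.

Lemma cpoly_sum (I : Type) (r : seq I) (P : pred I) (f : I -> tup -> C) df :
    (forall k, cpoly (f k) (df k)) ->
  cpoly (fun x => \sum_(k <- r | P k) f k x)
        (fun i x => \sum_(k <- r | P k) df k i x).
Proof.
move=> pf; elim: r => [|k r IH].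
  by apply: cpoly_eq (cpoly_cst 0) _ _ => [x|i x]; rewrite big_nil.
case Pk: (P k); last first.
  by apply: cpoly_eq IH _ _ => [x|i x]; rewrite big_cons Pk.
by apply: cpoly_eq (cpolyD (pf k) IH) _ _ => [x|i x]; rewrite big_cons Pk.
Qed.

Lemma cpoly_prod_seq (I : eqType) (r : seq I) (f : I -> tup -> C) df :
    (forall k, cpoly (f k) (df k)) -> uniq r ->
  cpoly (fun x => \prod_(k <- r) f k x)
        (fun i x => \sum_(k <- r) df k i x * \prod_(l <- r | l != k) f l x).
Proof.
move=> pf; elim: r => [_|k r IH /= /andP[kr ur]].
  by apply: cpoly_eq (cpoly_cst 1) _ _ => [x|i x]; rewrite big_nil.
apply: cpoly_eq (cpolyM (pf k) (IH ur)) _ _ => [x|i x]; rewrite big_cons //.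
rewrite big_cons eqxx /=; congr (_ * _ + _).
  rewrite [LHS]big_seq [RHS]big_seq_cond; apply: eq_bigl => l; apply/esym/andb_idr => lr.
  by apply: contraNneq kr => <-.
rewrite mulr_sumr; apply: eq_big_seq => l lr.
rewrite big_cons; have -> : k != l by apply: contraNneq kr => ->.
by rewrite mulrCA.
Qed.

Lemma cpoly_prod (I : finType) (f : I -> tup -> C) df :
    (forall k, cpoly (f k) (df k)) ->
  cpoly (fun x => \prod_k f k x)
        (fun i x => \sum_k df k i x * \prod_(l | l != k) f l x).
Proof.
by move=> pf; apply: cpoly_prod_seq => //; exact: index_enum_uniq.
Qed.

Lemma cpolyX k f df : cpoly f df ->
  cpoly (fun x => f x ^+ k) (fun i x => k%:R * f x ^+ k.-1 * df i x).
Proof.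
move=> pf; elim: k => [|k IH].
  by apply: cpoly_eq (cpoly_cst 1) _ _ => // i x; rewrite mul0r mul0r.
apply: cpoly_eq (cpolyM pf IH) _ _ => [x|i x] /=; first by rewrite exprS.
case: k {IH} => [|k] /=; first by rewrite expr0; ring.
by rewrite !exprS -[k.+2%:R]natr1; ring.
Qed.

Definition mxpoly p q (F : tup -> 'M[C]_(p, q)) (dF : 'I_m -> tup -> 'M[C]_(p, q)) :=
  forall a b, cpoly (fun x => F x a b) (fun i x => dF i x a b).

Lemma mxpoly_eq p q F G dF dG : @mxpoly p q F dF -> F =1 G ->
  (forall i, dF i =1 dG i) -> mxpoly G dG.
Proof.
move=> pf /funext <- H; suff <- : dF = dG by [].
by apply/funext => i; apply/funext => x; exact: H.
Qed.

Lemma mxpoly_cst p q (A : 'M[C]_(p, q)) : mxpoly (fun=> A) (fun _ _ => 0).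
Proof. by move=> a b; apply: cpoly_eq (cpoly_cst (A a b)) _ _ => // i x; rewrite mxE. Qed.

Lemma mxpolyD p q F dF G dG : @mxpoly p q F dF -> mxpoly G dG ->
  mxpoly (fun x => F x + G x) (fun i x => dF i x + dG i x).
Proof.
by move=> pF pG a b; apply: cpoly_eq (cpolyD (pF a b) (pG a b)) _ _ => [x|i x]; rewrite mxE.
Qed.

Lemma mxpolyN p q F dF : @mxpoly p q F dF -> mxpoly (fun x => - F x) (fun i x => - dF i x).
Proof.
by move=> pF a b; apply: cpoly_eq (cpolyN (pF a b)) _ _ => [x|i x]; rewrite mxE.
Qed.

Lemma mxpolyM p q r F dF G dG : @mxpoly p q F dF -> @mxpoly q r G dG ->
  mxpoly (fun x => F x *m G x) (fun i x => dF i x *m G x + F x *m dG i x).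
Proof.
move=> pF pG a b.
apply: cpoly_eq (@cpoly_sum _ (index_enum _) predT _ _
  (fun k => cpolyM (pF a k) (pG k b))) _ _ => [x|i x] /=; first by rewrite mxE.
by rewrite !mxE -big_split.
Qed.

Lemma mxpoly_scale p q f df F dF : cpoly f df -> @mxpoly p q F dF ->
  mxpoly (fun x => f x *: F x) (fun i x => df i x *: F x + f x *: dF i x).
Proof.
by move=> pf pF a b; apply: cpoly_eq (cpolyM pf (pF a b)) _ _ => [x|i x]; rewrite !mxE.
Qed.

Lemma mxpoly_sum p q (I : Type) (r : seq I) (P : pred I) (F : I -> tup -> 'M[C]_(p, q)) dF :
    (forall k, mxpoly (F k) (dF k)) ->
  mxpoly (fun x => \sum_(k <- r | P k) F k x)
         (fun i x => \sum_(k <- r | P k) dF k i x).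
Proof.
move=> pF a b; apply: cpoly_eq (@cpoly_sum _ r P _ _ (fun k => pF k a b)) _ _ => [x|i x];
  by rewrite summxE.
Qed.

Lemma cpoly_trace p F dF : @mxpoly p p F dF ->
  cpoly (fun x => \tr (F x)) (fun i x => \tr (dF i x)).
Proof. by move=> pF; exact: cpoly_sum. Qed.

(** Jacobi's formula. *)
Lemma cpoly_det p F dF : @mxpoly p p F dF ->
  cpoly (fun x => \det (F x)) (fun i x => \tr (\adj (F x) *m dF i x)).
Proof.
move=> pF.
pose H s := cpolyZ ((-1) ^+ (s : 'S_p)) (cpoly_prod (fun k => pF k (s k))).
apply: cpoly_eq (@cpoly_sum _ (index_enum _) predT _ _ H) _ _ => [x|i x] //=.
exact: trace_adj_mul.
Qed.

End complex_poly.

(** * The spectral theorem and contractions *)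

Section hermitian.
Context {R : realType}.
Local Notation C := R[i].
Local Notation Re := (@complex.Re R).
Local Notation Im := (@complex.Im R).
Local Notation toC := (real_complex R).

Definition hadj p q (A : 'M[C]_(p, q)) : 'M[C]_(q, p) := (map_mx conjc A)^T.

Lemma hadjM p q r (A : 'M[C]_(p, q)) (B : 'M[C]_(q, r)) : hadj (A *m B) = hadj B *m hadj A.
Proof. by rewrite /hadj map_mxM trmx_mul. Qed.

Lemma hadjD p q (A B : 'M[C]_(p, q)) : hadj (A + B) = hadj A + hadj B.
Proof. by rewrite /hadj map_mxD linearD. Qed.

Lemma hadjN p q (A : 'M[C]_(p, q)) : hadj (- A) = - hadj A.
Proof. by rewrite /hadj map_mxN linearN. Qed.

Lemma hadj_scalar n (a : R) : hadj (toC a)%:M = (toC a)%:M :> 'M[C]_n.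
Proof. by rewrite /hadj map_scalar_mx tr_scalar_mx /= oppr0. Qed.

Lemma hadj_sum p q (I : Type) (r : seq I) (P : pred I) (F : I -> 'M[C]_(p, q)) :
  hadj (\sum_(i <- r | P i) F i) = \sum_(i <- r | P i) hadj (F i).
Proof. by rewrite /hadj map_mx_sum linear_sum. Qed.

Lemma hadjZ p q (a : R) (A : 'M[C]_(p, q)) : hadj (toC a *: A) = toC a *: hadj A.
Proof. by apply/matrixP => i j; rewrite !mxE rmorphM /= oppr0. Qed.

Lemma mxtrace_hadj n (A : 'M[C]_n) : \tr (hadj A) = conjc (\tr A).
Proof. by rewrite /hadj mxtrace_tr raddf_sum; apply: eq_bigr => i _; rewrite mxE. Qed.

Definition nsq n (v : 'rV[C]_n) : R := \sum_j (Re (v 0 j) ^+ 2 + Im (v 0 j) ^+ 2).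

Lemma nsqE n (v : 'rV[C]_n) : (v *m hadj v) 0 0 = toC (nsq v).
Proof.
rewrite mxE rmorph_sum; apply: eq_bigr => j _; rewrite !mxE.
by case: (v 0 j) => a b /=; apply/eqP; rewrite eq_complex /=; apply/andP; split; apply/eqP; ring.
Qed.

Lemma nsq_ge0 n (v : 'rV[C]_n) : 0 <= nsq v.
Proof. by apply: sumr_ge0 => j _; rewrite addr_ge0 ?sqr_ge0. Qed.

Lemma nsq_eq0 n (v : 'rV[C]_n) : (nsq v == 0) = (v == 0).
Proof.
apply/eqP/eqP => [H|->]; last by rewrite /nsq big1 // => j _; rewrite mxE /= expr0n addr0.
apply/rowP => j; rewrite mxE; move/eqP: H.
rewrite psumr_eq0 => [/allP/(_ j)|k _]; last by rewrite addr_ge0 ?sqr_ge0.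
rewrite mem_index_enum => /(_ isT); rewrite paddr_eq0 ?sqr_ge0 // !sqrf_eq0.
by case: (v 0 j) => a b /= /andP[/eqP -> /eqP ->].
Qed.

Lemma nsq_add n (u v : 'rV[C]_n) (e : R) : 0 < e ->
  nsq (u + v) <= (1 + e) * nsq u + (1 + e^-1) * nsq v.
Proof.
move=> e0; rewrite /nsq !mulr_sumr -big_split /=; apply: ler_sum => j _.
rewrite mxE; case: (u 0 j) (v 0 j) => a b [a' b'] /=.
have key (x y : R) : (x + y) ^+ 2 <= (1 + e) * x ^+ 2 + (1 + e^-1) * y ^+ 2.
  rewrite -subr_ge0 (_ : _ - _ = e^-1 * (e * x - y) ^+ 2).
    by rewrite mulr_ge0 ?sqr_ge0 // invr_ge0 ltW.
  by field; rewrite gt_eqF.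
by have := key a a'; have := key b b'; lra.
Qed.

Lemma nsq_convex n (u v : 'rV[C]_n) (s : R) : 0 <= s <= 1 ->
  nsq (toC (1 - s) *: u + toC s *: v) <= (1 - s) * nsq u + s * nsq v.
Proof.
move=> /andP[s0 s1]; rewrite /nsq !mulr_sumr -big_split /=; apply: ler_sum => j _.
rewrite !mxE; case: (u 0 j) (v 0 j) => a b [a' b'] /=.
rewrite !mul0r !subr0 !addr0.
have key (x y : R) : ((1 - s) * x + s * y) ^+ 2 <= (1 - s) * x ^+ 2 + s * y ^+ 2.
  rewrite -subr_ge0 (_ : _ - _ = s * (1 - s) * (x - y) ^+ 2); last by ring.
  by rewrite mulr_ge0 ?sqr_ge0 // mulr_ge0 // subr_ge0.
by have := key a a'; have := key b b'; lra.
Qed.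

(** The bound [r] on the operator norm, for the action on row vectors. *)
Definition contr n (r : R) (S : 'M[C]_n) := forall v : 'rV[C]_n, nsq (v *m S) <= r ^+ 2 * nsq v.

Section spectral.
Variables (n : nat) (S : 'M[C]_n).
Hypothesis hS : hadj S = S.

(** The spectral theorem with a real spectrum given as a real row. *)
Lemma hermitian_spectral : exists (P : 'M[C]_n) (l : 'rV[R]_n),
  [/\ P *m hadj P = 1%:M, hadj P *m P = 1%:M &
      S = hadj P *m diag_mx (map_mx toC l) *m P].
Proof.
have hadjE (A : 'M[C]_n) : hadj A = map_mx Num.conj A^T.
  by apply/matrixP => i j; rewrite !mxE.
have Sh : S \is hermsymmx.
  by apply/is_hermitianmxP; rewrite expr0 scale1r -hadjE hS.
have /orthomx_spectralP SE := hermitian_normalmx Sh.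
have Sr := hermitian_spectral_diag_real Sh.
have Pu := spectral_unitarymx S.
exists (spectralmx S), (map_mx Re (spectral_diag S)).
have PP : spectralmx S *m hadj (spectralmx S) = 1%:M.
  by rewrite hadjE; exact/unitarymxP.
split; [exact: PP|exact: mulmx1C PP|].
rewrite [LHS]SE (invmx_unitary Pu) hadjE; congr (_ *m diag_mx _ *m _).
apply/rowP => j; rewrite !mxE /= RRe_real //.
by move/mxOverP: Sr.
Qed.

Variables (P : 'M[C]_n) (l : 'rV[R]_n).
Hypotheses (PP : P *m hadj P = 1%:M) (PP' : hadj P *m P = 1%:M)
  (SE : S = hadj P *m diag_mx (map_mx toC l) *m P).

Lemma nsq_unitary (v : 'rV[C]_n) : nsq (v *m P) = nsq v.
Proof.
by apply: complexI; rewrite -!nsqE hadjM mulmxA -(mulmxA v) PP mulmx1.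
Qed.

Lemma nsq_spectral (w : 'rV[C]_n) :
  nsq (w *m P *m S) = \sum_j l 0 j ^+ 2 * (Re (w 0 j) ^+ 2 + Im (w 0 j) ^+ 2).
Proof.
rewrite SE !mulmxA -(mulmxA w) PP mulmx1 nsq_unitary /nsq; apply: eq_bigr => j _.
rewrite mul_mx_diag !mxE; case: (w 0 j) => a b /=; ring.
Qed.

(** The test vectors are the rows of [P]. *)
Lemma contr_spectral r : contr r S <-> forall j, l 0 j ^+ 2 <= r ^+ 2.
Proof.
split=> [H j|H v].
  have := H (delta_mx 0 j *m P); rewrite nsq_unitary nsq_spectral /nsq.
  rewrite (bigD1 j) //= big1 => [|i /negbTE ij]; last by rewrite !mxE ij /= !expr0n /= addr0 mulr0.
  rewrite (bigD1 j) //= [X in _ <= _ * (_ + X)]big1 => [|i /negbTE ij]; last by rewrite !mxE ij /= !expr0n /= addr0.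
  by rewrite !mxE !eqxx /= expr1n expr0n /= !addr0 !mulr1.
have -> : v = v *m hadj P *m P by rewrite -mulmxA PP' mulmx1.
move: (v *m hadj P) => w; rewrite nsq_unitary nsq_spectral /nsq mulr_sumr.
by apply: ler_sum => j _; apply: ler_wpM2r (H j); rewrite addr_ge0 ?sqr_ge0.
Qed.

Lemma bound_spectral (rho : R) : (forall j, l 0 j ^+ 2 <= rho) ->
  forall v, nsq (v *m S) <= rho * nsq v.
Proof.
move=> H v; have -> : v = v *m hadj P *m P by rewrite -mulmxA PP' mulmx1.
move: (v *m hadj P) => w; rewrite nsq_unitary nsq_spectral /nsq mulr_sumr.
by apply: ler_sum => j _; apply: ler_wpM2r (H j); rewrite addr_ge0 ?sqr_ge0.
Qed.

Lemma conj_diagM (d e : 'rV[R]_n) :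
  (hadj P *m diag_mx (map_mx toC d) *m P) *m (hadj P *m diag_mx (map_mx toC e) *m P) =
  hadj P *m diag_mx (map_mx toC (\row_j (d 0 j * e 0 j))) *m P.
Proof.
rewrite !mulmxA -(mulmxA _ P) PP mulmx1 -(mulmxA (hadj P) (diag_mx _) (diag_mx _)) mulmx_diag.
by congr (_ *m diag_mx _ *m _); apply/rowP => j; rewrite !mxE rmorphM.
Qed.

Lemma det_spectral (r : R) :
  \det ((toC (r ^+ 2))%:M - S *m S) = toC (\prod_j (r ^+ 2 - l 0 j ^+ 2)).
Proof.
rewrite SE conj_diagM.
have -> : (toC (r ^+ 2))%:M = hadj P *m (toC (r ^+ 2))%:M *m P.
  by rewrite mul_mx_scalar -scalemxAl PP' scalemx1.
rewrite -mulmxBl -mulmxBr !det_mulmx mulrAC -det_mulmx PP' det1 mul1r.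
rewrite -diag_const_mx -linearB /= det_diag rmorph_prod; apply: eq_bigr => j _.
by rewrite !mxE -rmorphB expr2.
Qed.

Lemma trace_spectral k :
  \tr (iter k (fun X => S *m S *m X) 1%:M) = toC (\sum_j (l 0 j ^+ 2) ^+ k).
Proof.
have -> : iter k (fun X => S *m S *m X) 1%:M =
   hadj P *m diag_mx (map_mx toC (\row_j (l 0 j ^+ 2) ^+ k)) *m P.
  elim: k => [|k IH].
    rewrite (_ : map_mx _ _ = const_mx 1); last by apply/rowP => j; rewrite !mxE expr0.
    by rewrite diag_const_mx mulmx1 PP'.
  rewrite iterS IH SE !conj_diagM; congr (_ *m diag_mx _ *m _).
  by apply/rowP => j; rewrite !mxE (exprS (l 0 j ^+ 2)) [in RHS]expr2.
rewrite mxtrace_mulC mulmxA PP mul1mx mxtrace_diag rmorph_sum.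
by apply: eq_bigr => j _; rewrite !mxE.
Qed.

End spectral.
End hermitian.

(** * Contractions along a line *)

Section contraction.
Context {R : realType}.
Local Notation C := R[i].
Local Notation Re := (@complex.Re R).
Local Notation Im := (@complex.Im R).
Local Notation toC := (real_complex R).
Variable n : nat.
Implicit Types (S H : 'M[C]_n) (r : R).

Definition ydet r S : R := Re (\det ((toC (r ^+ 2))%:M - S *m S)).

Lemma det_contr r S : hadj S = S -> contr r S -> 0 <= ydet r S <= (r ^+ 2) ^+ n.
Proof.
move=> hS cS; have [P [l [PP PP' SE]]] := hermitian_spectral hS.
have /(contr_spectral PP PP' SE) lr := cS.
rewrite /ydet (det_spectral PP PP' SE) /=; apply/andP; split.
  by apply: prodr_ge0 => j _; rewrite subr_ge0.
rewrite -[X in _ <= _ ^+ X]card_ord -prodr_const; apply: ler_prod => j _.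
by rewrite subr_ge0 lr /= gerBl sqr_ge0.
Qed.

(** All the squared eigenvalues are at most [r^2] and none equals it, hence a
    uniform gap. *)
Lemma contr_strict r S : 0 < r -> hadj S = S -> contr r S -> ydet r S != 0 ->
  exists rho, [/\ 0 <= rho, rho < r ^+ 2 & forall v : 'rV[C]_n, nsq (v *m S) <= rho * nsq v].
Proof.
move=> r0 hS cS; have [P [l [PP PP' SE]]] := hermitian_spectral hS.
have /(contr_spectral PP PP' SE) lr := cS.
rewrite /ydet (det_spectral PP PP' SE) /= => /prodf_neq0 Hd.
exists (\big[Num.max/0]_j (l 0 j ^+ 2)); split.
- exact: bigmax_ge_id.
- elim/big_ind: _ => [|x y hx hy|j _]; first by rewrite exprn_gt0.
    by rewrite gt_max hx.
  by rewrite lt_neqAle lr andbT eq_sym -subr_eq0 Hd.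
- apply: (bound_spectral PP PP' SE) => j.
  exact: (le_bigmax _ (fun j => l 0 j ^+ 2) j).
Qed.

Lemma det_contr_lt r r' S : 0 <= r' -> r' < r -> hadj S = S -> contr r' S -> 0 < ydet r S.
Proof.
move=> r0 rr hS cS; have [P [l [PP PP' SE]]] := hermitian_spectral hS.
have /(contr_spectral PP PP' SE) lr := cS.
rewrite /ydet (det_spectral PP PP' SE) /=; apply: prodr_gt0 => j _.
rewrite subr_gt0; apply: le_lt_trans (lr j) _.
by rewrite ltr_pXn2r // ?nnegrE // ltW // (le_lt_trans r0).
Qed.

Lemma bernoulli (d : R) k : 0 <= d -> 1 + k%:R * d <= (1 + d) ^+ k.
Proof.
move=> d0; elim: k => [|k IH]; first by rewrite expr0; lra.
have k0 : 0 <= k%:R :> R by exact: ler0n.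
rewrite exprS -natr1; apply: (@le_trans _ _ ((1 + d) * (1 + k%:R * d))); first by nra.
by apply: ler_wpM2l IH; lra.
Qed.

(** A countable family of polynomial inequalities: if some squared eigenvalue
    exceeded [r^2], its powers would eventually exceed [n r^(2k)].  This is what
    makes the ball measurable. *)
Lemma contr_trace r S : 0 < r -> hadj S = S ->
  contr r S <-> forall k, Re (\tr (iter k (fun X => S *m S *m X) 1%:M)) <= n%:R * (r ^+ 2) ^+ k.
Proof.
move=> r0 hS; have [P [l [PP PP' SE]]] := hermitian_spectral hS.
rewrite (contr_spectral PP PP' SE); split=> [H k|H j].
  rewrite (trace_spectral PP PP' SE) /= -[X in X%:R]card_ord mulr_natl -sumr_const.
  by apply: ler_sum => j _; rewrite lerXn2r ?nnegrE ?sqr_ge0.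
rewrite leNgt; apply/negP => lt_rl.
have r2 : 0 < r ^+ 2 by rewrite exprn_gt0.
pose d := l 0 j ^+ 2 / r ^+ 2 - 1.
have d0 : 0 < d by rewrite subr_gt0 ltr_pdivlMr // mul1r.
(* Bernoulli's inequality makes the powers of [1 + d] unbounded. *)
have key k : 1 + k%:R * d <= n%:R.
  apply: le_trans (bernoulli k (ltW d0)) _; rewrite /d addrC subrK expr_div_n.
  rewrite ler_pdivrMr ?exprn_gt0 //; apply: le_trans (H k).
  rewrite (trace_spectral PP PP' SE) /= (bigD1 j) //= lerDl.
  by apply: sumr_ge0 => i _; rewrite exprn_ge0 ?sqr_ge0.
have := archi_boundP (divr_ge0 (ler0n R n) (ltW d0)).
rewrite ltr_pdivrMr // => H1; have := key (Num.bound (n%:R / d)).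
by lra.
Qed.

Lemma hermitian_bounded H : hadj H = H ->
  exists2 L, 0 <= L & forall v : 'rV[C]_n, nsq (v *m H) <= L * nsq v.
Proof.
move=> hH; have [P [l [PP PP' SE]]] := hermitian_spectral hH.
exists (\sum_j l 0 j ^+ 2); first by apply: sumr_ge0 => j _; rewrite sqr_ge0.
apply: (bound_spectral PP PP' SE) => j; rewrite (bigD1 j) //= lerDl.
by apply: sumr_ge0 => i _; rewrite sqr_ge0.
Qed.

Lemma nsqZ (t : R) (v : 'rV[C]_n) : nsq (toC t *: v) = t ^+ 2 * nsq v.
Proof.
rewrite /nsq mulr_sumr; apply: eq_bigr => j _; rewrite mxE.
by case: (v 0 j) => a b /=; ring.
Qed.

Lemma convex_comb_le (c a b N : R) : 0 <= c <= 1 -> a <= N -> b <= N ->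
  (1 - c) * a + c * b <= N.
Proof.
move=> /andP[c0 c1] aN bN; have c1' : 0 <= 1 - c by rewrite subr_ge0.
by have := ler_wpM2l c0 bN; have := ler_wpM2l c1' aN; lra.
Qed.

Section line.
Variables (r : R) (S H : 'M[C]_n).
Hypotheses (r0 : 0 < r) (hS : hadj S = S) (hH : hadj H = H).
Let T (t : R) := S + toC t *: H.
Let A := [set t | contr r (T t)].

Let TE (v : 'rV[C]_n) t t0 : v *m T t = v *m T t0 + toC (t - t0) *: (v *m H).
Proof.
by rewrite /T !mulmxDr -!scalemxAr -addrA -scalerDl -rmorphD /= [t0 + _]addrC subrK.
Qed.

Let hT t : hadj (T t) = T t.
Proof. by rewrite /T hadjD hadjZ hS hH. Qed.

Lemma contr_closed t0 : (forall e, 0 < e -> exists2 t, A t & `|t - t0| <= e) -> A t0.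
Proof.
move=> H0 v; rewrite leNgt; apply/negP.
set N := nsq v; set X := nsq (v *m T t0) => NX.
have N0 : 0 <= N by exact: nsq_ge0.
set M := nsq (v *m H); have M0 : 0 <= M by exact: nsq_ge0.
pose K := r ^+ 2 * N + 2 * M + 1.
have r2 : 0 <= r ^+ 2 by exact: sqr_ge0.
have K0 : 0 < K by rewrite /K; nra.
have g0 : 0 < X - r ^+ 2 * N by rewrite subr_gt0.
(* With [|t - t0| <= e <= 1], [nsq_add] at [e] costs at most [e * K]. *)
pose e := Num.min 1 ((X - r ^+ 2 * N) / K / 2).
have e0 : 0 < e by rewrite lt_min ltr01 /= !divr_gt0.
have e1 : e <= 1 by rewrite ge_min lexx.
have eK : 2 * e * K <= X - r ^+ 2 * N.
  rewrite -ler_pdivlMr // mulrC -ler_pdivlMr //; by rewrite /e ge_min lexx orbT.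
have [t At tt0] := H0 _ e0.
have h1 := nsq_add (v *m T t) (toC (t0 - t) *: (v *m H)) e0.
rewrite -TE nsqZ -/X -/M in h1.
have h2 : (t0 - t) ^+ 2 <= e ^+ 2.
  by rewrite -real_normK ?num_real // distrC lerXn2r // nnegrE // ltW.
have h3 := At v; rewrite -/N in h3.
have h4 : (1 + e^-1) * ((t0 - t) ^+ 2 * M) <= (e ^+ 2 + e) * M.
  rewrite mulrA; apply: ler_wpM2r => //.
  apply: (@le_trans _ _ ((1 + e^-1) * e ^+ 2)).
    by apply: ler_wpM2l => //; rewrite addr_ge0 // invr_ge0 ltW.
  by rewrite le_eqVlt; apply/orP; left; apply/eqP; field; rewrite gt_eqF.
have h5 : (1 + e) * nsq (v *m T t) <= (1 + e) * (r ^+ 2 * N).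
  by apply: ler_wpM2l => //; lra.
have h6 : e ^+ 2 * M <= e * M by apply: ler_wpM2r => //; rewrite expr2 -[leRHS]mulr1 ler_wpM2l // ltW.
have : X <= r ^+ 2 * N + e * K by rewrite /K; lra.
have : 0 < e * K by rewrite mulr_gt0.
lra.
Qed.

(** A contraction with nonzero gap determinant stays a contraction along a short
    part of the line, by the uniform gap of [contr_strict]. *)
Lemma contr_open t0 : A t0 -> ydet r (T t0) != 0 ->
  exists2 e, 0 < e & forall t, `|t - t0| <= e -> A t.
Proof.
move=> At0 dt0; have [rho [rho0 rhor Hrho]] := contr_strict r0 (hT t0) At0 dt0.
have [L L0 HL] := hermitian_bounded hH.
have r2 : 0 < r ^+ 2 by rewrite exprn_gt0.
pose g := r ^+ 2 - rho; have g0 : 0 < g by rewrite subr_gt0.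
(* Half of the gap absorbs the factor [1 + h], the other half the displacement. *)
pose h := g / (2 * r ^+ 2).
have h0 : 0 < h by rewrite divr_gt0 // mulr_gt0.
pose K := (1 + h^-1) * (L + 1).
have h'0 : 0 < h^-1 by rewrite invr_gt0.
have K0 : 0 < K by rewrite mulr_gt0 //; lra.
pose e := Num.min 1 (g / 2 / K).
have e0 : 0 < e by rewrite lt_min ltr01 /= !divr_gt0.
have e1 : e <= 1 by rewrite ge_min lexx.
have eK : e * K <= g / 2 by rewrite -ler_pdivlMr // /e ge_min lexx orbT.
exists e; first exact: e0.
move=> t te v; rewrite (TE v t t0).
apply: le_trans (nsq_add _ _ h0) _; rewrite nsqZ.
have N0 : 0 <= nsq v by exact: nsq_ge0.
have a1 : (1 + h) * nsq (v *m T t0) <= (1 + h) * (rho * nsq v).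
  by apply: ler_wpM2l (Hrho v); lra.
have a2 : (1 + h) * rho <= rho + g / 2.
  rewrite mulrDl mul1r lerD2l /h mulrAC ler_pdivrMr ?mulr_gt0 //.
  rewrite mulrA divfK ?pnatr_eq0 //; apply: ler_wpM2l; rewrite ltW //.
have a3 : (t - t0) ^+ 2 <= e.
  rewrite -real_normK ?num_real //; apply: (@le_trans _ _ (e ^+ 2)).
    by rewrite lerXn2r // nnegrE // ltW.
  by rewrite expr2 -[leRHS]mulr1 ler_wpM2l // ltW.
have a4 : (1 + h^-1) * ((t - t0) ^+ 2 * nsq (v *m H)) <= g / 2 * nsq v.
  apply: le_trans (_ : e * K * nsq v <= _); last exact: ler_wpM2r.
  rewrite (_ : e * K * nsq v = (1 + h^-1) * (e * ((L + 1) * nsq v))); last by rewrite /K; ring.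
  apply: ler_wpM2l; first by lra.
  by apply: ler_pM => //; rewrite ?sqr_ge0 ?nsq_ge0 //; have := HL v; lra.
have a5 : (1 + h) * rho * nsq v <= (rho + g / 2) * nsq v by exact: ler_wpM2r.
by rewrite (_ : r ^+ 2 = rho + g / 2 + g / 2); [nra|rewrite /g; lra].
Qed.

Lemma contr_itv s t u : A s -> A u -> s <= t <= u -> A t.
Proof.
move=> As Au /andP[st tu].
have [su|] := ltP s u; last first.
  by move=> us; have <- : s = t by apply/eqP; rewrite eq_le st (le_trans tu us).
move=> v; pose c := (t - s) / (u - s).
have us0 : 0 < u - s by rewrite subr_gt0.
have c01 : 0 <= c <= 1.
  rewrite /c; apply/andP; split; first by rewrite divr_ge0 ?subr_ge0 // ltW.
  by rewrite ler_pdivrMr // mul1r lerD2r.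
have -> : v *m T t = toC (1 - c) *: (v *m T s) + toC c *: (v *m T u).
  rewrite (TE v u s) (TE v t s) scalerDr addrA -scalerDl -rmorphD /= subrK scale1r.
  by rewrite scalerA -rmorphM /= /c divfK // gt_eqF.
apply: le_trans (nsq_convex _ _ c01) _.
exact: (convex_comb_le c01 (As v) (Au v)).
Qed.

(** On a line the contractions form a bounded closed convex set.  At an end the
    gap determinant vanishes, since otherwise the segment could be prolonged. *)
Lemma contr_line L : (forall t, A t -> `|t| <= L) ->
  A = set0 \/ exists a b, [/\ a <= b, A = `[a, b]%classic,
    ydet r (T a) = 0 & ydet r (T b) = 0].
Proof.
move=> AL; have [A0|/set0P A0] := eqVneq A set0; [by left|right].
have Aub : has_ubound A by exists L => t /AL; rewrite ler_norml => /andP[].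
have Alb : has_lbound A by exists (- L) => t /AL; rewrite ler_norml => /andP[].
have hsup : has_sup A by [].
have hinf : has_inf A by [].
have As : A (sup A).
  apply: contr_closed => e e0; have [t At et] := sup_adherent e0 hsup.
  exists t => //; have := ub_le_sup Aub At => ts.
  by rewrite distrC ger0_norm ?subr_ge0 //; lra.
have Ai : A (inf A).
  apply: contr_closed => e e0; have [t At et] := inf_adherent e0 hinf.
  exists t => //; have := ge_inf Alb At => ts.
  by rewrite ger0_norm ?subr_ge0 //; lra.
exists (inf A), (sup A); split.
- exact: ub_le_sup.
- apply/seteqP; split => t; rewrite /= in_itv /=; last exact: contr_itv.
  by move=> At; rewrite (ub_le_sup Aub At) (ge_inf Alb At).
- apply/eqP; apply: contraT => /(contr_open Ai)[e e0 He].
  have /(ge_inf Alb) : A (inf A - e).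
    by apply: He; rewrite addrAC subrr add0r normrN gtr0_norm.
  by lra.
- apply/eqP; apply: contraT => /(contr_open As)[e e0 He].
  have /(ub_le_sup Aub) : A (sup A + e).
    by apply: He; rewrite addrAC subrr add0r gtr0_norm.
  by lra.
Qed.

End line.
End contraction.

(** * The operator norm ball in coordinates *)

(** The sum of the squared eigenvalues dominates each of them. *)
Lemma contr_frobenius (R : realType) n (r : R) (S : 'M[R[i]]_n) : hadj S = S ->
  complex.Re (\tr (S *m S)) <= r ^+ 2 -> contr r S.
Proof.
move=> hS; have [P [l [PP PP' SE]]] := hermitian_spectral hS.
have := trace_spectral PP PP' SE 1; rewrite /= mulmx1 => -> /= H.
apply/(contr_spectral PP PP' SE) => j; apply: le_trans H.
rewrite (bigD1 j) //= expr1 lerDl.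
by apply: sumr_ge0 => i _; rewrite expr1 sqr_ge0.
Qed.

Lemma det_real (R : realType) n (r : R) (S : 'M[R[i]]_n) : hadj S = S ->
  \det ((real_complex R (r ^+ 2))%:M - S *m S) = real_complex R (ydet r S).
Proof.
move=> hS; have [P [l [PP PP' SE]]] := hermitian_spectral hS.
by rewrite /ydet (det_spectral PP PP' SE).
Qed.

Section operator_ball.
Context {R : realType} {m n : nat}.
Local Notation C := R[i].
Local Notation Re := (@complex.Re R).
Local Notation Im := (@complex.Im R).
Local Notation toC := (real_complex R).
Local Notation tup := (m.-tuple (measurableTypeR R)).
Local Notation leb := (lebesgue_tuple R m).
Variables (S : 'I_m -> 'M[C]_n).

Definition comb (x : tup) : 'M[C]_n := \sum_b toC (tnth x b) *: S b.

Definition opball (r : R) : set tup := [set x | contr r (comb x)].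

Hypothesis hS : forall b, hadj (S b) = S b.
Hypothesis onS : forall a b, \tr (S a *m S b) = (a == b)%:R.
Variable r : R.
Hypothesis r0 : 0 < r.

Lemma hadj_comb x : hadj (comb x) = comb x.
Proof. by rewrite hadj_sum; apply: eq_bigr => b _; rewrite hadjZ hS. Qed.

Lemma mxpoly_comb : mxpoly comb (fun i _ => S i).
Proof.
have H b := mxpoly_scale (cpoly_coord b) (mxpoly_cst (S b)).
apply: mxpoly_eq (@mxpoly_sum _ _ _ _ _ (index_enum _) predT _ _ H) _ _ => [x|i x] //=.
rewrite (bigD1 i) //= eqxx scale1r scaler0 addr0 big1 ?addr0 // => b bi.
by rewrite eq_sym (negbTE bi) scale0r scaler0 addr0.
Qed.

Lemma trace_comb b x : \tr (S b *m comb x) = toC (tnth x b).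
Proof.
rewrite mulmx_sumr raddf_sum (bigD1 b) //= big1 => [|a ab].
  by rewrite -scalemxAr mxtraceZ onS eqxx mulr1 addr0.
by rewrite -scalemxAr mxtraceZ onS eq_sym (negbTE ab) mulr0.
Qed.

Lemma trace_comb2 x : Re (\tr (comb x *m comb x)) = \sum_b tnth x b ^+ 2.
Proof.
have -> : \tr (comb x *m comb x) = toC (\sum_b tnth x b ^+ 2); last by [].
rewrite {1}/comb mulmx_suml [LHS]raddf_sum rmorph_sum; apply: eq_bigr => b _.
by rewrite /= -scalemxAl mxtraceZ trace_comb -rmorphM expr2.
Qed.

Definition opradius (s : R) : R := 1 + n%:R * s ^+ 2.

(** For an orthonormal family the sum of the squared coordinates is the sum of the
    squared eigenvalues, at most [n s^2]; the radius of the cube comes from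
    [t^2 <= u -> t <= 1 + u]. *)
Lemma opball_cube s : 0 < s -> opball s `<=` cube (opradius s).
Proof.
move=> s0 x /(contr_trace s0 (hadj_comb x))/(_ 1%N); rewrite /= mulmx1 expr1 trace_comb2.
move=> H b; have : tnth x b ^+ 2 <= n%:R * s ^+ 2.
  apply: le_trans H; rewrite (bigD1 b) //= lerDl.
  by apply: sumr_ge0 => i _; rewrite sqr_ge0.
rewrite -real_normK ?num_real // /opradius; set t := `|_| => Ht.
have t0 : 0 <= t by exact: normr_ge0.
by nra.
Qed.

Lemma opradius_ge0 s : 0 <= opradius s.
Proof. by rewrite addr_ge0 // mulr_ge0 ?ler0n ?sqr_ge0. Qed.

Lemma measurable_opball s : 0 < s -> measurable (opball s).
Proof.
move=> s0; pose F k x := Re (\tr (iter k (fun X => comb x *m comb x *m X) 1%:M)).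
have -> : opball s = \bigcap_k (F k @^-1` `]-oo, n%:R * (s ^+ 2) ^+ k]).
  apply/seteqP; split => x.
    move=> /(contr_trace s0 (hadj_comb x)) H k _; rewrite /= in_itv /=; exact: H.
  move=> H; apply/(contr_trace s0 (hadj_comb x)) => k.
  by have := H k I; rewrite /= in_itv.
apply: bigcap_measurable => // k _; rewrite -[X in measurable X]setTI.
have [dG pG] : exists dG, mxpoly (fun x => iter k (fun X => comb x *m comb x *m X) 1%:M) dG.
  elim: k => [|k [dG pG]]; first by eexists; exact: mxpoly_cst.
  by eexists; apply: mxpolyM pG; apply: mxpolyM; exact: mxpoly_comb.
have [pF _] := cpoly_trace pG.
exact: (poly_fun_measurable pF).
Qed.

Lemma opball_finite : leb (opball r) = (fine (leb (opball r)))%:E.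
Proof.
rewrite fineK // ge0_fin_numE //; apply: le_lt_trans.
  apply: le_measure; last exact: opball_cube.
  - by rewrite inE; exact: measurable_opball.
  - by rewrite inE; exact: measurable_cube.
by rewrite [X in (X < _)%E](lebesgue_cube m (opradius_ge0 r)) ltry.
Qed.

(** The ball contains a small cube, by the Hilbert-Schmidt bound. *)
Lemma volume_opball_gt0 : 0 < volume (opball r).
Proof.
pose d := r / m.+1%:R.
have d0 : 0 < d by rewrite divr_gt0.
have cb : cube d `<=` opball r.
  move=> x xd; apply: (contr_frobenius (hadj_comb x)); rewrite trace_comb2.
  apply: (@le_trans _ _ (\sum_(b < m) d ^+ 2)).
    apply: ler_sum => b _; rewrite -real_normK ?num_real //.
    by rewrite lerXn2r // nnegrE // ltW.
  rewrite sumr_const card_ord -mulr_natl /d expr_div_n mulrA ler_pdivrMr ?exprn_gt0 //.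
  rewrite mulrC; apply: ler_wpM2l; first by rewrite sqr_ge0.
  by rewrite -natrX ler_nat; apply: leq_trans (leqnSn m) _; rewrite -mulnn leq_pmulr.
have : ((((2 * d) ^+ m)%:E : \bar R) <= leb (opball r))%E.
  rewrite -(lebesgue_cube m (ltW d0)).
  apply: le_measure cb; first by rewrite inE; exact: measurable_cube.
  by rewrite inE; exact: measurable_opball.
rewrite opball_finite lee_fin; apply: lt_le_trans.
by rewrite exprn_gt0 // mulr_gt0.
Qed.

Lemma comb_scale c x : comb (scale_tuple c x) = toC c *: comb x.
Proof.
rewrite scaler_sumr; apply: eq_bigr => b _.
by rewrite tnth_mktuple scalerA rmorphM.
Qed.

Lemma opball_scale c : 0 < c -> opball (c * r) = scale_tuple c^-1 @^-1` opball r.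
Proof.
move=> c0; apply/seteqP; split => x H v.
  rewrite comb_scale -scalemxAr nsqZ exprVn mulrC ler_pdivrMr ?exprn_gt0 //.
  by have := H v; rewrite exprMn; lra.
have := H v; rewrite comb_scale -scalemxAr nsqZ exprVn mulrC ler_pdivrMr ?exprn_gt0 //.
by rewrite exprMn; lra.
Qed.

Lemma bernoulliN (e : R) k : 0 <= e <= 1 -> 1 - k%:R * e <= (1 - e) ^+ k.
Proof.
move=> /andP[e0 e1]; elim: k => [|k IH]; first by rewrite expr0; lra.
have k0 : 0 <= k%:R :> R by exact: ler0n.
rewrite exprS -natr1; apply: (@le_trans _ _ ((1 - e) * (1 - k%:R * e))).
  by have := mulr_ge0 k0 (mulr_ge0 e0 e0); lra.
by apply: ler_wpM2l IH; lra.
Qed.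

Lemma measurable_ydet : measurable_fun setT (fun x => ydet r (comb x)).
Proof.
have [pD _] := cpoly_det (mxpolyD (mxpoly_cst (toC (r ^+ 2))%:M)
  (mxpolyN (mxpolyM mxpoly_comb mxpoly_comb))).
exact: (poly_fun_measurable pD).
Qed.

(** The boundary is disjoint from the ball shrunk by [1 - e], whose volume is at
    least [1 - m e] times that of the ball; let [e] tend to [0]. *)
Lemma opball_boundary_null : leb (opball r `&` [set x | ydet r (comb x) = 0]) = 0%E.
Proof.
set Z := _ `&` _.
have mB := measurable_opball r0.
have mZ : measurable Z.
  apply: measurableI => //; rewrite -[X in measurable X]setTI.
  have -> : [set x | ydet r (comb x) = 0] = (fun x => ydet r (comb x)) @^-1` [set 0] by [].
  exact: measurable_ydet.
have Zle : (leb Z <= leb (opball r))%E.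
  by apply: le_measure; rewrite ?inE //; exact: subIsetl.
have Zfin : leb Z = (fine (leb Z))%:E.
  rewrite fineK // ge0_fin_numE //; apply: le_lt_trans Zle _.
  by rewrite opball_finite ltry.
set z := fine (leb Z) in Zfin; pose v := fine (leb (opball r)).
have z0 : 0 <= z by exact: fine_ge0.
have v0 : 0 <= v by exact: fine_ge0.
have key e : 0 < e -> e < 1 -> z <= m%:R * e * v.
  move=> e0 e1; pose t := 1 - e; have t0 : 0 < t by rewrite subr_gt0.
  have mB' : measurable (opball (t * r)) by apply: measurable_opball; exact: mulr_gt0.
  have : (leb Z + leb (opball (t * r)) <= leb (opball r))%E.
    rewrite -measureU //.
      apply: le_measure; rewrite ?inE //; first exact: measurableU.
      move=> x [[]//|Bx u]; apply: le_trans (Bx u) _; apply: ler_wpM2r; first exact: nsq_ge0.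
      rewrite lerXn2r ?nnegrE ?mulr_ge0 // ?ltW //.
      by rewrite -[ltRHS]mul1r ltr_pM2r // /t; lra.
    apply/seteqP; split => // x [[_ /= dx0] Bx]; have := det_contr_lt _ _ (hadj_comb x) Bx.
    move=> /(_ r); rewrite dx0 ltxx => H; apply/notF; apply: H.
      by rewrite mulr_ge0 // ltW.
    by rewrite -[ltRHS]mul1r ltr_pM2r // /t; lra.
  rewrite opball_scale // lebesgue_scale ?invr_gt0 // -exprVn invrK Zfin opball_finite -EFinM -EFinD lee_fin.
  have := @bernoulliN e m; rewrite -/t -/v ltW //= ltW // => /(_ isT) H1 H2.
  by have := ler_wpM2r v0 H1; lra.
rewrite Zfin; congr EFin; apply/eqP; rewrite eq_le z0 andbT leNgt; apply/negP => zp.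
pose K := m%:R * v + 1.
have K0 : 0 < K by rewrite ltr_wpDl // mulr_ge0.
pose e := Num.min (1 / 2) (z / K / 2).
have e0 : 0 < e by rewrite lt_min !divr_gt0.
have e1 : e < 1 by rewrite gt_min; apply/orP; left; lra.
have eK : 2 * e * K <= z.
  by rewrite -ler_pdivlMr // mulrC -ler_pdivlMr // /e ge_min lexx orbT.
have := key e e0 e1; rewrite /K in eK; lra.
Qed.

Lemma comb_set_coord x i t :
  comb (set_coord x i t) = (comb x - toC (tnth x i) *: S i) + toC t *: S i.
Proof.
rewrite /comb (bigD1 i) //= [X in _ = X - _ + _](bigD1 i) //=.
rewrite tnth_set_coord eqxx [X in _ = X - _ + _]addrC addrK addrC; congr (_ + _).
by apply: eq_bigr => b /negbTE bi; rewrite tnth_set_coord bi.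
Qed.

Lemma opball_slice x i : set_coord x i @^-1` opball r = set0 \/
  exists a b, [/\ a <= b, set_coord x i @^-1` opball r = `[a, b]%classic,
    ydet r (comb (set_coord x i a)) = 0 & ydet r (comb (set_coord x i b)) = 0].
Proof.
pose A := comb x - toC (tnth x i) *: S i.
have hA : hadj A = A by rewrite hadjD hadjN hadjZ hS hadj_comb.
have -> : set_coord x i @^-1` opball r = [set t | contr r (A + toC t *: S i)].
  by apply/seteqP; split => t; rewrite /= /opball /= comb_set_coord.
have := @contr_line _ _ r A (S i) r0 hA (hS i) (opradius r).
case=> [t Ht||[a [b [H1 H2 H3 H4]]]]; [|by left|].
- have /opball_cube : opball r (set_coord x i t) by rewrite /opball /= comb_set_coord.
  by move=> /(_ r0 i); rewrite tnth_set_coord eqxx.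
- right; exists a, b; rewrite !comb_set_coord.
  by split; [exact: H1|exact: H2|exact: H3|exact: H4].
Qed.

End operator_ball.

(** * Removal of the cutoff *)

Section cutoff.
Context {R : realType} {m : nat}.
Local Notation tup := (m.-tuple (measurableTypeR R)).
Local Notation leb := (lebesgue_tuple R m).

Definition is_poly (f : tup -> R) := exists df, poly_fun f df.

Lemma is_poly_cst c : is_poly (fun=> c).
Proof. by eexists; exact: PolyCst. Qed.

Lemma is_polyD f g : is_poly f -> is_poly g -> is_poly (fun x => f x + g x).
Proof. by move=> [df pf] [dg pg]; eexists; exact: PolyAdd pf pg. Qed.

Lemma is_polyM f g : is_poly f -> is_poly g -> is_poly (fun x => f x * g x).
Proof. by move=> [df pf] [dg pg]; eexists; exact: PolyMul pf pg. Qed.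

Lemma is_polyN f : is_poly f -> is_poly (fun x => - f x).
Proof.
move=> pf; rewrite (_ : (fun x => _) = fun x => -1 * f x); last first.
  by apply/funext => x; rewrite mulN1r.
exact: is_polyM (is_poly_cst _) pf.
Qed.

Lemma is_polyB f g : is_poly f -> is_poly g -> is_poly (fun x => f x - g x).
Proof. by move=> pf pg; exact: is_polyD pf (is_polyN pg). Qed.

Lemma is_polyX f k : is_poly f -> is_poly (fun x => f x ^+ k).
Proof.
move=> pf; elim: k => [|k IH]; first exact: is_poly_cst.
by under eq_fun do rewrite exprS; exact: is_polyM.
Qed.

Lemma is_poly_sum I (s : seq I) (f : I -> tup -> R) : (forall k, is_poly (f k)) ->
  is_poly (fun x => \sum_(k <- s) f k x).
Proof.
move=> pf; elim: s => [|k s IH].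
  by under eq_fun do rewrite big_nil; exact: is_poly_cst.
by under eq_fun do rewrite big_cons; exact: is_polyD.
Qed.

Variables (K : set tup) (L : R).
Hypotheses (L0 : 0 <= L) (mK : measurable K) (KL : K `<=` cube L).

Lemma is_poly_integrable f : is_poly f -> leb.-integrable K (EFin \o f).
Proof. by move=> [df pf]; exact: poly_fun_integrable L0 mK KL _ _ pf. Qed.

Lemma Rintegral_sum0 I (s : seq I) (f : I -> tup -> R) : (forall k, is_poly (f k)) ->
    (forall k, \int[leb]_(x in K) f k x = 0) ->
  \int[leb]_(x in K) (\sum_(k <- s) f k x) = 0.
Proof.
move=> pf f0; elim: s => [|k s IH].
  under eq_Rintegral do rewrite big_nil.
  by rewrite Rintegral_cst // mul0r.
under eq_Rintegral do rewrite big_cons.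
rewrite RintegralD //; first by rewrite f0 IH addr0.
- exact: is_poly_integrable.
- by apply: is_poly_integrable; exact: is_poly_sum.
Qed.

Variable z : tup -> R.
Hypotheses (pz : is_poly z) (z01 : forall x, K x -> 0 <= z x <= 1).
Hypothesis z1_null : leb (K `&` [set x | z x = 1]) = 0%E.

(** Dominated convergence: the powers of [z] tend to [0] off the null set where
    [z = 1]. *)
Lemma cvg_integral_pow : (\int[leb]_(x in K) z x ^+ k) @[k --> \oo] --> (0 : R).
Proof.
have mz k : measurable_fun K (fun x => (z x ^+ k)%:E).
  apply/measurable_EFinP; have [dz pzk] := is_polyX k pz.
  exact: measurable_funS (poly_fun_measurable pzk).
have mz1 : measurable (K `&` [set x | z x = 1]).
  apply: measurableI => //; rewrite -[X in measurable X]setTI.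
  have -> : [set x | z x = 1] = z @^-1` [set 1] by [].
  by have [dz pz'] := pz; exact: (poly_fun_measurable pz').
have [] := @dominated_convergence _ _ R leb K mK (fun k x => (z x ^+ k)%:E) (cst 0%E) (cst 1%E).
- exact: mz.
- exact: measurable_cst.
- exists (K `&` [set x | z x = 1]); split => // x /= Hx.
  split; apply: contrapT => Hn; apply: Hx => Kx.
    by case: Hn.
  have /andP[z0 zle1] := z01 Kx.
  apply/fine_cvgP; split; first by near=> k.
  apply: cvg_expr; rewrite ger0_norm // lt_neqAle zle1 andbT.
  by apply/eqP.
- exact: (is_poly_integrable (is_poly_cst 1)).
- apply: aeW => x k Kx; have /andP[z0 zle1] := z01 Kx.
  by rewrite /= lee_fin normrX ger0_norm // exprn_ile1.
move=> _ _; rewrite integral0 => H.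
by exact: (fine_cvg H).
Unshelve. all: by end_near.
Qed.

(** The sum of [t^j (1 - t)] for [j <= k] telescopes, and its last term is the
    least. *)
Lemma pow_mul_bound (t : R) k : 0 <= t <= 1 -> k.+1%:R * t ^+ k * (1 - t) <= 1 - t ^+ k.+1.
Proof.
move=> /andP[t0 t1]; elim: k => [|k IH]; first by rewrite expr0 expr1; lra.
have h1 : t ^+ k.+1 * (1 - t) <= 1 * (1 - t).
  by apply: ler_wpM2r; [lra|exact: exprn_ile1].
have h2 := ler_wpM2l t0 IH; rewrite -natr1.
have e1 : t ^+ k.+2 = t * t ^+ k.+1 by rewrite exprS.
have e2 : t ^+ k.+1 = t * t ^+ k by rewrite exprS.
rewrite e1; rewrite e2 in h1 h2 *; lra.
Qed.

(** The term with [H] comes from differentiating the cutoff.  Since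
    [(k+1) z^k (1 - z) <= 1], its coefficient is at most [2 z^k], and so is
    what the cutoff removes from [G] up to a constant; the integral of [z^k]
    tends to [0]. *)
Lemma cutoff_limit G H : is_poly G -> is_poly H ->
    (forall k, \int[leb]_(x in K) ((1 - z x ^+ k.*2.+2) * G x
        - k.*2.+2%:R * z x ^+ k.*2.+1 * (1 - z x) * H x) = 0) ->
  \int[leb]_(x in K) G x = 0.
Proof.
move=> pG pH GH0.
have [M M0 GM] : exists2 M, 0 <= M & forall x, K x -> `|G x| <= M /\ `|H x| <= M.
  have [[dG pG'] [dH pH']] := (pG, pH).
  have [M1 b1] := poly_fun_bounded L pG'; have [M2 b2] := poly_fun_bounded L pH'.
  exists (Num.max 0 (Num.max M1 M2)); first by rewrite le_max lexx.
  by move=> x /KL xL; rewrite !le_max b1 ?b2 ?orbT.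
have key k : `|\int[leb]_(x in K) G x| <= 3 * M * \int[leb]_(x in K) z x ^+ k.
  (* [G] minus the integrand of the hypothesis. *)
  pose E x := z x ^+ k.*2.+2 * G x + k.*2.+2%:R * z x ^+ k.*2.+1 * (1 - z x) * H x.
  have pE : is_poly E.
    apply: is_polyD; first by apply: is_polyM => //; exact: is_polyX.
    apply: is_polyM => //; apply: is_polyM; last by apply: is_polyB => //; exact: is_poly_cst.
    by apply: is_polyM; [exact: is_poly_cst|exact: is_polyX].
  have -> : \int[leb]_(x in K) G x = \int[leb]_(x in K) E x.
    rewrite -[LHS]subr0 -[X in _ - X](GH0 k) -RintegralB //.
    - by apply: eq_Rintegral => x _; rewrite /E; ring.
    - exact: is_poly_integrable.
    - rewrite (_ : (fun x => _) = fun x => G x - E x); last by apply/funext => x; rewrite /E; ring.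
      by apply: is_poly_integrable; exact: is_polyB.
  apply: le_trans (le_normr_Rintegral mK (is_poly_integrable pE)) _.
  have pzk : is_poly (fun x => z x ^+ k) by exact: is_polyX.
  rewrite -RintegralZl //; last exact: is_poly_integrable.
  apply: le_Rintegral => //.
  - exact: (integrable_abse (is_poly_integrable pE)).
  - by apply: is_poly_integrable; apply: is_polyM => //; exact: is_poly_cst.
  move=> x Kx; have [GMx HMx] := GM x Kx; have /andP[t0 t1] := z01 Kx.
  rewrite /E; move: (z x) (G x) (H x) GMx HMx t0 t1 => t g h gM hM t0 t1.
  have tk0 : 0 <= t ^+ k by exact: exprn_ge0.
  have tk1 : t ^+ k <= 1 by exact: exprn_ile1.
  have h1 : t ^+ k.*2.+2 <= t ^+ k.
    by apply: ler_wiXn2l => //; rewrite -addnn -!addnS leq_addr.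
  have h2 : k.*2.+2%:R * t ^+ k.*2.+1 * (1 - t) <= 2 * t ^+ k.
    have := @pow_mul_bound t k; rewrite t0 t1 => /(_ isT) hb.
    rewrite -doubleS -muln2 natrM -addnn -addnS exprD exprS.
    rewrite (_ : _ * _ * _ = 2 * t ^+ k * (t * (k.+1%:R * t ^+ k * (1 - t)))); last by ring.
    rewrite -[leRHS]mulr1; apply: ler_wpM2l; first by rewrite mulr_ge0.
    have hb1 : k.+1%:R * t ^+ k * (1 - t) <= 1.
      by apply: le_trans hb _; rewrite gerBl exprn_ge0.
    apply: le_trans (ler_wpM2l t0 hb1) _; by rewrite mulr1.
  have h3 : 0 <= k.*2.+2%:R * t ^+ k.*2.+1 * (1 - t).
    by rewrite !mulr_ge0 ?ler0n ?exprn_ge0 // subr_ge0.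
  apply: le_trans (ler_normD _ _) _.
  have h0 : 0 <= t ^+ k.*2.+2 by exact: exprn_ge0.
  rewrite (normrM (t ^+ k.*2.+2) g) (normrM (_ * _ * _) h) (ger0_norm h0) (ger0_norm h3).
  have := ler_pM h0 (normr_ge0 g) h1 gM.
  by have := ler_pM h3 (normr_ge0 h) h2 hM; lra.
apply/eqP; rewrite -normr_le0 leNgt; apply/negP => a0.
set a := `|_| in a0 key.
have e0 : 0 < a / (3 * M + 1) by rewrite divr_gt0 // ltr_wpDl // mulr_ge0.
have : \forall k \near \oo, `|\int[leb]_(x in K) z x ^+ k| < a / (3 * M + 1).
  by apply: cvgr0_norm_lt; [exact: cvg_integral_pow|].
move=> [N _ /(_ N (leqnn N))]; set I := (X in `|X|) => HI.
have := key N; rewrite -/I => HK.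
have hI : I < a / (3 * M + 1) by apply: le_lt_trans (ler_norm _) HI.
rewrite ltr_pdivlMr in hI; last by rewrite ltr_wpDl // mulr_ge0.
have I0 : 0 <= I by apply: Rintegral_ge0 => x /z01/andP[? _]; exact: exprn_ge0.
lra.
Qed.

End cutoff.

(** * The divergence theorem on the ball *)

Lemma anticomm_field (K : comNzRingType) n (T Y W W' : 'M[K]_n) : T *m Y = Y *m T ->
  (Y *m W + W' *m Y) *m T + T *m (Y *m W + W' *m Y) =
  Y *m (T *m W + W *m T) + (T *m W' + W' *m T) *m Y.
Proof.
move=> YT; have e1 : T *m (Y *m W) = Y *m (T *m W) by rewrite mulmxA YT -mulmxA.
have e2 : W' *m Y *m T = W' *m T *m Y by rewrite -mulmxA -YT mulmxA.
rewrite !mulmxDl !mulmxDr e1 e2 -!mulmxA addrACA.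
by congr (_ + _); exact: addrC.
Qed.

(** Multiplying [Y] by its adjugate on either side gives the determinant, so no
    inverse of [Y] is needed where it is singular. *)
Lemma trace_adj_mulD (K : comNzRingType) n (Y P Q : 'M[K]_n) :
  \tr (\adj Y *m (Y *m P + Q *m Y)) = \det Y * (\tr P + \tr Q).
Proof.
rewrite mulmxDr mxtraceD mulmxA mul_adj_mx mul_scalar_mx mxtraceZ.
by rewrite mxtrace_mulC -mulmxA mul_mx_adj mul_mx_scalar mxtraceZ mulrDr.
Qed.

Section divergence.
Context {R : realType} {m n : nat}.
Local Notation C := R[i].
Local Notation Re := (@complex.Re R).
Local Notation Im := (@complex.Im R).
Local Notation toC := (real_complex R).
Local Notation tup := (m.-tuple (measurableTypeR R)).
Local Notation leb := (lebesgue_tuple R m).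

Lemma mxpoly_hadj p q (F : tup -> 'M[C]_(p, q)) dF : mxpoly F dF ->
  mxpoly (fun x => hadj (F x)) (fun i x => hadj (dF i x)).
Proof.
move=> pF a b; have [p1 p2] := pF b a; split.
  apply: poly_fun_eq p1 _ _ => [x|i x] /=; rewrite !mxE.
    by case: (F x b a).
  by case: (dF i x b a).
apply: poly_fun_eq (PolyMul (PolyCst (-1)) p2) _ _ => [x|i x] /=; rewrite !mxE.
  by case: (F x b a) => ? ? /=; rewrite mulN1r.
by case: (dF i x b a) => ? ? /=; rewrite mul0r add0r mulN1r.
Qed.

Variables (S : 'I_m -> 'M[C]_n).
Hypothesis hS : forall b, hadj (S b) = S b.
Hypothesis onS : forall a b, \tr (S a *m S b) = (a == b)%:R.
Variable r : R.
Hypothesis r0 : 0 < r.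
Local Notation comb := (comb S).
Local Notation opball := (opball S r).

(** The matrix [r^2 - T^2], positive definite inside the ball and singular on its
    boundary. *)
Definition gap (x : tup) : 'M[C]_n := (toC (r ^+ 2))%:M - comb x *m comb x.
Definition dgap (i : 'I_m) (x : tup) : 'M[C]_n := - (S i *m comb x + comb x *m S i).

Lemma mxpoly_gap : mxpoly gap dgap.
Proof.
apply: mxpoly_eq (mxpolyD (mxpoly_cst _)
  (mxpolyN (mxpolyM (mxpoly_comb S) (mxpoly_comb S)))) _ _ => // i x.
exact: add0r.
Qed.

Lemma gap_comm x : comb x *m gap x = gap x *m comb x.
Proof. by rewrite /gap mulmxBr mulmxBl mul_mx_scalar mul_scalar_mx mulmxA. Qed.

Lemma Re_mulC (a : R) (w : C) : Re (toC a * w) = a * Re w.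
Proof. by case: w => u v /=; ring. Qed.

Lemma Re_subC (u w : C) : Re (u - w) = Re u - Re w.
Proof. by case: u w => a b [c d]. Qed.

Section field.
Variables (W : tup -> 'M[C]_n) (dW : 'I_m -> tup -> 'M[C]_n).
Hypothesis pW : mxpoly W dW.
Variables (f : tup -> C) (df : 'I_m -> tup -> C).
Hypothesis pf : cpoly f df.

(** The tangent field attached to [W]. *)
Definition field x := gap x *m W x + hadj (W x) *m gap x.
Definition dfield i x := dgap i x *m W x + gap x *m dW i x +
  (hadj (dW i x) *m gap x + hadj (W x) *m dgap i x).

Lemma mxpoly_field : mxpoly field dfield.
Proof. exact: mxpolyD (mxpolyM mxpoly_gap pW) (mxpolyM (mxpoly_hadj pW) mxpoly_gap). Qed.

Hypothesis fieldE : forall x, field x = \sum_b \tr (S b *m field x) *: S b.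

(** Minus the logarithmic derivative of the determinant of [gap] along the field. *)
Definition rate x := \tr (comb x *m W x + W x *m comb x) +
  \tr (comb x *m hadj (W x) + hadj (W x) *m comb x).

(** This is tangency in algebraic form: along [field] the determinant is
    multiplied by a polynomial, hence its zero set is preserved.  The
    derivative of the gap is [- (V T + T V)], which [anticomm_field] writes as
    [Y] times a matrix plus a matrix times [Y]. *)
Lemma derive_det_field x :
  \sum_b \tr (\adj (gap x) *m dgap b x) * \tr (S b *m field x) =
  - (\det (gap x) * rate x).
Proof.
pose V := field x; pose T := comb x; pose Y := gap x.
have -> : \sum_b \tr (\adj Y *m dgap b x) * \tr (S b *m V) =
    - \tr (\adj Y *m (V *m T + T *m V)).
  rewrite {2 3}/V fieldE mulmx_suml mulmx_sumr -big_split mulmx_sumr.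
  rewrite [\tr (\sum_(_ <- _) _)]raddf_sum -sumrN /=.
  apply: eq_bigr => b _; rewrite /dgap -/T mulmxN raddfN mulNr; congr (- _).
  by rewrite -scalemxAl -scalemxAr -scalerDr -scalemxAr mxtraceZ mulrC.
congr (- _); rewrite {}/V /field -/Y.
have YT : T *m Y = Y *m T by exact: gap_comm.
rewrite (anticomm_field _ _ YT).
by rewrite trace_adj_mulD.
Qed.

(** The divergence of the field [f V] in the coordinates of the basis [S]. *)
Definition divf x := \sum_b (df b x * \tr (S b *m field x) + f x * \tr (S b *m dfield b x)).

Let c : R := ((r ^+ 2) ^+ n)^-1.
Let z x : R := 1 - c * ydet r (comb x).
Let zC x : C := 1 - toC c * \det (gap x).

Let zCE x : zC x = toC (z x).
Proof. by rewrite /zC /z (det_real r (hadj_comb hS x)) rmorphB rmorphM rmorph1. Qed.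

Let pzC : cpoly zC (fun i x => - (toC c * \tr (\adj (gap x) *m dgap i x))).
Proof.
apply: cpoly_eq (cpolyB (cpoly_cst 1) (cpolyZ (toC c) (cpoly_det mxpoly_gap))) _ _ => // i x.
exact: add0r.
Qed.

Let v b x := \tr (S b *m field x).
Let dv b i x := \tr (S b *m dfield i x).

Let pv b : cpoly (v b) (dv b).
Proof.
apply: cpoly_eq (cpoly_trace (mxpolyM (mxpoly_cst (S b)) mxpoly_field)) _ _ => // i x.
by rewrite mul0mx add0r.
Qed.

Let pz : is_poly z.
Proof.
have [p1 _] := pzC; exists (fun i x => Re (- (toC c * \tr (\adj (gap x) *m dgap i x)))).
by apply: poly_fun_eq p1 _ _ => // x; rewrite zCE.
Qed.

Let K0 : 0 <= opradius (n := n) r := opradius_ge0 r.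
Let mK := measurable_opball hS r0.
Let KL := opball_cube hS onS r0.

Let c0 : 0 < c. Proof. by rewrite invr_gt0 !exprn_gt0. Qed.

Let z01 x : opball x -> 0 <= z x <= 1.
Proof.
move=> Bx; have /andP[h1 h2] := det_contr (hadj_comb hS x) Bx.
rewrite /z subr_ge0 gerBl mulr_ge0 ?(ltW c0) // andbT.
by rewrite mulrC ler_pdivrMr ?exprn_gt0 // mul1r.
Qed.

Let z1_null : leb (opball `&` [set x | z x = 1]) = 0%E.
Proof.
rewrite -(opball_boundary_null hS onS r0); congr (leb (_ `&` _)).
apply/seteqP; split => x /= H.
  have /eqP : c * ydet r (comb x) = 0 by move: H; rewrite /z; lra.
  by rewrite mulf_eq0 (gt_eqF c0) => /eqP.
by rewrite /z H mulr0 subr0.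
Qed.

(** The cutoff [1 - z^N] vanishes on the boundary, and the integral of each
    [b]-th partial derivative of the [b]-th component is zero by
    [integral_partial0].  What remains is the situation of [cutoff_limit]. *)
Theorem divergence_ball : \int[leb]_(x in opball) Re (divf x) = 0.
Proof.
have pfv b := cpolyM pf (pv b).
have pG : is_poly (fun x => Re (divf x)).
  rewrite (_ : (fun x => _) = fun x => \sum_b
     Re (df b x * v b x + f x * dv b b x)); last first.
    by apply/funext => x; rewrite /divf raddf_sum.
  apply: is_poly_sum => b; have [p1 _] := pfv b.
  exact: (poly_fun_partial b p1).
have pH : is_poly (fun x => Re (f x * rate x)).
  have pr : exists dr, cpoly rate dr.
    have pc := mxpoly_comb S; have ph := mxpoly_hadj pW.
    eexists; exact: cpolyD (cpoly_trace (mxpolyD (mxpolyM pc pW) (mxpolyM pW pc)))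
      (cpoly_trace (mxpolyD (mxpolyM pc ph) (mxpolyM ph pc))).
  by have [dr pr'] := pr; have [p1 _] := cpolyM pf pr'; eexists; exact: p1.
apply: (cutoff_limit K0 mK KL pz z01 z1_null pG pH) => k.
set N := k.*2.+2.
(* [dg b] is the gradient of the [b]-th component of the cut off field. *)
have pphi := cpolyB (cpoly_cst 1) (cpolyX N pzC).
have pg b := cpolyM pphi (pfv b).
pose g b := fun x : tup => Re ((1 - zC x ^+ N) * (f x * v b x)).
pose dg (b i : 'I_m) (x : tup) := Re (
  (0 - N%:R * zC x ^+ N.-1 * - (toC c * \tr (\adj (gap x) *m dgap i x))) * (f x * v b x) +
  (1 - zC x ^+ N) * (df i x * v b x + f x * dv b i x)).
have pgr b : poly_fun (g b) (dg b) by have [] := pg b.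
transitivity (\int[leb]_(x in opball) \sum_b dg b b x); last first.
  apply: (Rintegral_sum0 K0 mK KL) => b; first exact: poly_fun_partial (pgr b).
  apply: (integral_partial0 K0 mK KL (pgr b)) => x.
  have [->|[a1 [a2 [h1 h2 h3 h4]]]] := opball_slice hS onS r0 x b; [by left|right].
  have z1 y : ydet r (comb y) = 0 -> g b y = 0.
    by move=> Hy; rewrite /g zCE /z Hy mulr0 subr0 expr1n subrr mul0r.
  by exists a1, a2; split; [exact: h1|exact: h2|exact: z1|exact: z1].
apply: eq_Rintegral => x _; rewrite -raddf_sum /=.
have e1 (t : R) : toC (1 - t ^+ N) = 1 - toC t ^+ N by rewrite rmorphB rmorph1 rmorphXn.
have e2 (s t : R) : toC (N%:R * t ^+ N.-1 * s) = N%:R * toC t ^+ N.-1 * toC s.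
  by rewrite !rmorphM rmorphXn rmorph_nat.
have -> : \sum_b ((0 - N%:R * zC x ^+ N.-1 * - (toC c * \tr (\adj (gap x) *m dgap b x))) *
    (f x * v b x) + (1 - zC x ^+ N) * (df b x * v b x + f x * dv b b x)) =
  toC (1 - z x ^+ N) * divf x - toC (N%:R * z x ^+ N.-1 * (1 - z x)) * (f x * rate x).
  rewrite big_split /= -mulr_sumr addrC; congr (_ + _).
    by rewrite zCE -e1.
  rewrite (eq_bigr (fun b => N%:R * zC x ^+ N.-1 * f x * toC c *
     (\tr (\adj (gap x) *m dgap b x) * \tr (S b *m field x)))); last first.
    by move=> b _; rewrite /v; ring.
  rewrite -mulr_sumr derive_det_field zCE e2.
  have -> : toC (1 - z x) = toC c * \det (gap x).
    by rewrite (det_real r (hadj_comb hS x)) -rmorphM; congr toC; rewrite /z; ring.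
  by rewrite /=; ring.
by rewrite Re_subC !Re_mulC.
Qed.

End field.
End divergence.

(** * Casimir sums of a complete basis *)

Section casimir.
Variables (K : comNzRingType) (m n : nat) (S : 'I_m -> 'M[K]_n) (c1 c2 : K).
Hypothesis completeS : forall i p q j : 'I_n,
  \sum_b S b i p * S b q j = c1 * ((i == j) && (p == q))%:R + c2 * ((i == q) && (p == j))%:R.

(** Symmetry of [X] when [c2] is regular, and no condition when [c2 = 0]: this
    lets real symmetric and complex Hermitian matrices share one argument. *)
Definition symm (X : 'M[K]_n) := c2 *: X^T = c2 *: X.

(** Completeness turns the left-hand side into [c1 X + c2 X^T]. *)
Lemma expansion X : c1 + c2 = 1 -> symm X -> \sum_b \tr (S b *m X) *: S b = X.
Proof.
move=> c12 /matrixP sX; apply/matrixP => i p; rewrite summxE.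
transitivity (\sum_q \sum_j X j q * (\sum_b S b i p * S b q j)).
  under [RHS]eq_bigr => q _ do under eq_bigr => j _ do rewrite mulr_sumr.
  under [RHS]eq_bigr => q _ do rewrite exchange_big.
  rewrite exchange_big; apply: eq_bigr => b _; rewrite mxE /mxtrace mulr_suml.
  apply: eq_bigr => q _; rewrite mxE mulr_suml; apply: eq_bigr => j _; ring.
transitivity (\sum_q \sum_j (c1 * X j q * (i == j)%:R * (p == q)%:R + c2 * X j q * (i == q)%:R * (p == j)%:R)).
  apply: eq_bigr => q _; apply: eq_bigr => j _; rewrite completeS -!mulnb !natrM; ring.
rewrite (eq_bigr (fun q => c1 * X i q * (p == q)%:R + c2 * X p q * (i == q)%:R)); last first.
  move=> q _; rewrite big_split /=; congr (_ + _).
    rewrite (bigD1 i) //= eqxx big1 => [|j /negbTE ji]; last by rewrite (eq_sym i) ji !(mulr0, mul0r).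
    by rewrite /=; ring.
  rewrite (bigD1 p) //= eqxx big1 => [|j /negbTE jp]; last by rewrite (eq_sym p) jp !(mulr0, mul0r).
  by rewrite /=; ring.
rewrite big_split /= (bigD1 p) //= eqxx big1 => [|j /negbTE jp]; last by rewrite (eq_sym p) jp !(mulr0, mul0r).
rewrite (bigD1 i) //= eqxx big1 => [|j /negbTE jp]; last by rewrite (eq_sym i) jp !(mulr0, mul0r).
have := sX i p; rewrite !mxE => E.
by rewrite !mulr1 !addr0 E -mulrDl c12 mul1r.
Qed.

(** Completeness gives [sum_b S_b X S_b = c1 tr X + c2 X^T]. *)
Lemma casimir (X Z : 'M[K]_n) :
  \sum_b \tr (S b *m X *m S b *m Z) = c1 * (\tr X * \tr Z) + c2 * \tr (X^T *m Z).
Proof.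
have -> : c1 * (\tr X * \tr Z) + c2 * \tr (X^T *m Z) =
    \tr ((c1 * \tr X)%:M *m Z + c2 *: (X^T *m Z)).
  by rewrite mxtraceD mul_scalar_mx !mxtraceZ mulrA.
rewrite scalemxAl -mulmxDl -raddf_sum -mulmx_suml; congr (\tr (_ *m Z)).
apply/matrixP => i j; rewrite summxE.
transitivity (\sum_q \sum_p X p q * (\sum_b S b i p * S b q j)).
  under [RHS]eq_bigr => q _ do under eq_bigr => p _ do rewrite mulr_sumr.
  under [RHS]eq_bigr => q _ do rewrite exchange_big.
  rewrite exchange_big; apply: eq_bigr => b _; rewrite mxE.
  apply: eq_bigr => q _; rewrite mxE mulr_suml; apply: eq_bigr => p _; ring.
rewrite (eq_bigr (fun q => c1 * X q q * (i == j)%:R + c2 * X j q * (i == q)%:R)); last first.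
  move=> q _.
  rewrite (eq_bigr (fun p => (c1 * X p q * (i == j)%:R) * (p == q)%:R + (c2 * X p q * (i == q)%:R) * (p == j)%:R)); last first.
    by move=> p _; rewrite completeS -!mulnb !natrM; ring.
  rewrite big_split /=; congr (_ + _).
    rewrite (bigD1 q) //= eqxx big1 => [|p /negbTE pq]; last by rewrite pq mulr0.
    by rewrite mulr1 addr0.
  rewrite (bigD1 j) //= eqxx big1 => [|p /negbTE pq]; last by rewrite pq mulr0.
  by rewrite mulr1 addr0.
rewrite big_split /= !mxE; congr (_ + _).
  by rewrite -mulr_suml -mulr_sumr mulr_natr.
rewrite (bigD1 i) //= eqxx big1 => [|q /negbTE qi]; last by rewrite eq_sym qi mulr0.
by rewrite mulr1 addr0.
Qed.

Lemma casimir1 (Z : 'M[K]_n) :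
  \sum_b \tr (S b *m S b *m Z) = (c1 * n%:R + c2) * \tr Z.
Proof.
have := casimir 1%:M Z; under eq_bigr do rewrite mulmx1.
by move=> ->; rewrite mxtrace1 trmx1 mul1mx mulrDl mulrA.
Qed.

Lemma casimir_symm (X Z : 'M[K]_n) : symm X ->
  \sum_b \tr (S b *m X *m S b *m Z) = c1 * (\tr X * \tr Z) + c2 * \tr (X *m Z).
Proof. by move=> sX; rewrite casimir -!mxtraceZ !scalemxAl sX. Qed.

Let g := c1 * n%:R + c2.

(** The divergence of [Y A + A Y]: differentiating one factor [T] at a time leaves
    four Casimir sums. *)
Lemma div_constant (A T : 'M[K]_n) : symm A -> symm T ->
  \sum_b \tr (S b *m (- (S b *m T + T *m S b) *m A + A *m - (S b *m T + T *m S b))) =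
  - ((2 * g + 2 * c2) * \tr (A *m T) + 2 * c1 * (\tr A * \tr T)).
Proof.
move=> sA sT.
transitivity (- (\sum_b \tr (S b *m S b *m (T *m A)) + \sum_b \tr (S b *m T *m S b *m A) +
   (\sum_b \tr (S b *m A *m S b *m T) + \sum_b \tr (S b *m S b *m (A *m T))))).
  rewrite -!big_split -sumrN /=; apply: eq_bigr => b _.
  rewrite !(mulNmx, mulmxN, mulmxDl, mulmxDr) !mxtraceD !raddfN /= !mxtraceD !mulmxA.
  rewrite (mxtrace_mulC (S b *m A *m T) (S b)) !mulmxA; ring.
rewrite !casimir1 !casimir_symm // (mxtrace_mulC T A) /g; ring.
Qed.

(** The divergence of [Y A T + T A Y]. *)
Lemma div_linear (A T Y : 'M[K]_n) rr : symm A -> symm T -> Y = rr%:M - T *m T ->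
  \sum_b \tr (S b *m (- (S b *m T + T *m S b) *m (A *m T) + Y *m (A *m S b) +
     (S b *m A *m Y + T *m A *m - (S b *m T + T *m S b)))) =
  2 * g * (rr * \tr A) - (4 * g + 2 * c2) * \tr (A *m T *m T) -
  2 * c1 * (\tr T * \tr (A *m T)).
Proof.
move=> sA sT YE.
have sTA : c2 * \tr ((T *m A)^T *m T) = c2 * \tr (A *m T *m T).
  by rewrite trmx_mul -!mxtraceZ !scalemxAl sA -scalemxAl scalemxAr sT -scalemxAr scalemxAl.
transitivity (- (\sum_b \tr (S b *m S b *m (T *m (A *m T))) + \sum_b \tr (S b *m T *m S b *m (A *m T)))
   + (\sum_b \tr (S b *m S b *m (Y *m A)) + \sum_b \tr (S b *m S b *m (A *m Y)))
   - (\sum_b \tr (S b *m (T *m A) *m S b *m T) + \sum_b \tr (S b *m S b *m (T *m A *m T)))).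
  rewrite -!big_split -!sumrN -!big_split /=; apply: eq_bigr => b _.
  rewrite !(mulNmx, mulmxN, mulmxDl, mulmxDr) !mxtraceD !raddfN /= !mxtraceD !mulmxA.
  rewrite (mxtrace_mulC (S b *m T *m A *m T) (S b)) (mxtrace_mulC (S b *m Y *m A) (S b)) !mulmxA; ring.
have tY : \tr (A *m Y) = rr * \tr A - \tr (A *m T *m T).
  by rewrite YE mulmxBr mul_mx_scalar raddfB /= mxtraceZ mulmxA.
rewrite !casimir1 (casimir_symm _ sT) casimir sTA (mxtrace_mulC Y A) tY.
rewrite mulmxA (mxtrace_mulC (T *m A) T) (mxtrace_mulC T (T *m A)) -!mulmxA.
rewrite [\tr (T *m (A *m T))]mxtrace_mulC (mxtrace_mulC T A) -!mulmxA /g; ring.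
Qed.

End casimir.

(** * Moments of the ball *)

Section symm.
Variables (K : comNzRingType) (n : nat) (c : K).
Implicit Types X Y Z : 'M[K]_n.

Lemma symm1 : symm c (1%:M : 'M[K]_n).
Proof. by rewrite /symm trmx1. Qed.

Lemma symm_scalar a : symm c (a%:M : 'M[K]_n).
Proof. by rewrite /symm tr_scalar_mx. Qed.

Lemma symmD X Y : symm c X -> symm c Y -> symm c (X + Y).
Proof. by rewrite /symm linearD !scalerDr => -> ->. Qed.

Lemma symmN X : symm c X -> symm c (- X).
Proof. by rewrite /symm linearN !scalerN => ->. Qed.

Lemma symmZ a X : symm c X -> symm c (a *: X).
Proof. by rewrite /symm linearZ /= !scalerA mulrC -!scalerA => ->. Qed.

Lemma symm_mul X Y : symm c X -> symm c Y -> c *: (X *m Y)^T = c *: (Y *m X).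
Proof. by move=> sX sY; rewrite trmx_mul [LHS]scalemxAl sY -scalemxAl [LHS]scalemxAr sX -scalemxAr. Qed.

Lemma symm_sqr X : symm c X -> symm c (X *m X).
Proof. by move=> sX; rewrite /symm symm_mul. Qed.

Lemma symm_anticomm X Y : symm c X -> symm c Y -> symm c (X *m Y + Y *m X).
Proof.
by move=> sX sY; rewrite /symm linearD scalerDr !symm_mul // [in RHS]addrC scalerDr.
Qed.

Lemma symm_anticomm3 X Y Z : symm c X -> symm c Y -> symm c Z ->
  symm c (X *m (Y *m Z) + Z *m Y *m X).
Proof.
move=> sX sY sZ.
have key (U V T : 'M[K]_n) : symm c U -> symm c V -> symm c T ->
    c *: (U *m (V *m T))^T = c *: (T *m V *m U).
  by move=> sU sV sT; rewrite trmx_mul [LHS]scalemxAl symm_mul // -scalemxAl [LHS]scalemxAr sU -scalemxAr.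
rewrite /symm linearD !scalerDr key // -[Z *m Y *m X]mulmxA key //.
by rewrite addrC !mulmxA.
Qed.

End symm.

Lemma discriminant_gt0 (R : realFieldType) (a b e : R) :
  2 <= a -> 0 <= b -> e <= 1 -> 0 < (2 * a + 2 * b) * a - 2 * e.
Proof.
move=> a2 b0 e1; have a0 : 0 <= a by exact: le_trans a2.
have h1 := ler_pM (ler0n R 2) (ler0n R 2) a2 a2.
by have h2 := mulr_ge0 b0 a0; lra.
Qed.

Section moments.
Context {R : realType} {m n : nat}.
Local Notation C := R[i].
Local Notation Re := (@complex.Re R).
Local Notation toC := (real_complex R).
Local Notation tup := (m.-tuple (measurableTypeR R)).
Local Notation leb := (lebesgue_tuple R m).
Variables (S : 'I_m -> 'M[C]_n) (c1 c2 r : R).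
Hypothesis n0 : (0 < n)%N.
Hypothesis r0 : 0 < r.
Hypothesis hS : forall b, hadj (S b) = S b.
Hypothesis onS : forall a b, \tr (S a *m S b) = (a == b)%:R.
Hypothesis completeS : forall i p q j : 'I_n, \sum_b S b i p * S b q j =
  toC c1 * ((i == j) && (p == q))%:R + toC c2 * ((i == q) && (p == j))%:R.
Hypothesis symS : forall b, symm (toC c2) (S b).
Hypothesis c1_gt0 : 0 < c1.
Hypothesis c2_ge0 : 0 <= c2.
Hypothesis c12 : c1 + c2 = 1.

Local Notation comb := (comb S).
Local Notation ball := (opball S r).
Local Notation csymm := (symm (toC c2)).
Let K0 : 0 <= opradius (n := n) r := opradius_ge0 r.
Let mK := measurable_opball hS r0.
Let KL := opball_cube hS onS r0.
Let Int (f : tup -> R) : R := \int[leb]_(x in ball) f x.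
Let V : R := volume ball.

Let V0 : 0 < V. Proof. exact: volume_opball_gt0. Qed.

Let toC12 : toC c1 + toC c2 = 1.
Proof. by rewrite -rmorphD c12 rmorph1. Qed.

Definition rtr (X : 'M[C]_n) : R := Re (\tr X).

Lemma trace_real (X : 'M[C]_n) : \tr (hadj X) = \tr X -> \tr X = toC (rtr X).
Proof.
rewrite mxtrace_hadj /rtr; case: (\tr X) => a b [] /= H.
by apply/eqP; rewrite eq_complex /= eqxx /=; apply/eqP; lra.
Qed.

Lemma trace_real2 (A B : 'M[C]_n) : hadj A = A -> hadj B = B ->
  \tr (A *m B) = toC (rtr (A *m B)).
Proof. by move=> hA hB; apply: trace_real; rewrite hadjM hA hB mxtrace_mulC. Qed.

Let comb_symm x : csymm (comb x).
Proof.
rewrite /comb; elim/big_ind: _ => [|X Y|b _]; [|exact: symmD|exact/symmZ/symS].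
by rewrite /symm trmx0.
Qed.

Let gap_symm x : csymm (gap S r x).
Proof. by apply: symmD; [exact: symm_scalar|apply/symmN/symm_sqr]. Qed.

Let g : R := c1 * n%:R + c2.
Let gamma : R := 2 * g.
Let tau k : R := rtr (S k).
Let t (x : tup) : R := rtr (comb x).
Let u k (x : tup) : R := rtr (S k *m comb x *m comb x).

Let trace_S k : \tr (S k) = toC (tau k).
Proof. by apply: trace_real; rewrite hS. Qed.

Let trace_T x : \tr (comb x) = toC (t x).
Proof. by apply: trace_real; rewrite hadj_comb. Qed.

Let trace_STT k x : \tr (S k *m comb x *m comb x) = toC (u k x).
Proof.
by apply: trace_real; rewrite !hadjM !hadj_comb // hS mulmxA mxtrace_mulC mulmxA.
Qed.

Let poly_x k : is_poly (fun x : tup => tnth x k).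
Proof. by eexists; exact: PolyCoord. Qed.

Let poly_t : is_poly t.
Proof. by have [p _] := cpoly_trace (mxpoly_comb S); eexists; exact: p. Qed.

Let poly_u k : is_poly (u k).
Proof.
have pc := mxpoly_comb S.
by have [p _] := cpoly_trace (mxpolyM (mxpolyM (mxpoly_cst (S k)) pc) pc); eexists; exact: p.
Qed.

Let IntD f h : is_poly f -> is_poly h -> Int (fun x => f x + h x) = Int f + Int h.
Proof.
by move=> pf ph; rewrite /Int RintegralD //; apply: (is_poly_integrable K0 mK KL).
Qed.

Let IntZ a f : is_poly f -> Int (fun x => a * f x) = a * Int f.
Proof. by move=> pf; rewrite /Int RintegralZl //; apply: (is_poly_integrable K0 mK KL). Qed.

Let IntC a : Int (fun=> a) = a * V.
Proof. exact: Rintegral_cst. Qed.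

Let Int_sum (f : 'I_m -> tup -> R) : (forall k, is_poly (f k)) ->
  Int (fun x => \sum_k f k x) = \sum_k Int (f k).
Proof.
move=> pf; elim: (index_enum _) => [|k s IH].
  by rewrite big_nil -[RHS](mul0r V) -IntC; congr Int; apply/funext => x; rewrite big_nil.
rewrite big_cons -IH -IntD //; last exact: is_poly_sum.
by congr Int; apply/funext => x; rewrite big_cons.
Qed.

Section constant_field.
Variable A : 'M[C]_n.
Hypotheses (hA : hadj A = A) (sA : csymm A).

Let pW := mxpoly_cst A (R := R) (m := m).

Let fieldE x : field S r (fun=> A) x =
  \sum_b \tr (S b *m field S r (fun=> A) x) *: S b.
Proof.
apply/esym/(expansion completeS) => //.
by rewrite /field hA; apply: symm_anticomm.
Qed.

Let trace_A : \tr A = toC (rtr A).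
Proof. by apply: trace_real; rewrite hA. Qed.

Let a (x : tup) := rtr (A *m comb x).

Let divergence_constant x :
  \sum_b \tr (S b *m dfield S r (fun=> A) (fun _ _ => 0) b x) =
  toC (- ((gamma + 2 * c2) * a x + 2 * c1 * rtr A * t x)).
Proof.
transitivity (\sum_b \tr (S b *m (- (S b *m comb x + comb x *m S b) *m A +
    A *m - (S b *m comb x + comb x *m S b)))).
  apply: eq_bigr => b _; rewrite /dfield hA mulmx0 addr0.
  by rewrite (_ : hadj 0 = 0) ?mul0mx ?add0r // /hadj map_mx0 trmx0.
rewrite (div_constant completeS sA (comb_symm x)) trace_A trace_T.
rewrite (trace_real2 hA (hadj_comb hS x)) -/(a x) /gamma /g.
rewrite !(rmorphN, rmorphD, rmorphM, rmorph_nat) /=; ring.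
Qed.

(** The divergence theorem for [W = A] and [f = 1]. *)
Lemma mean_constant : (gamma + 2 * c2) * Int a + 2 * c1 * rtr A * Int t = 0.
Proof.
have pa : is_poly a.
  have pc := mxpoly_comb S.
  by have [p _] := cpoly_trace (mxpolyM (mxpoly_cst A) pc); eexists; exact: p.
have := divergence_ball hS onS r0 pW (cpoly_cst 1) fieldE.
rewrite (_ : (fun x => _) = fun x => - (gamma + 2 * c2) * a x + (- (2 * c1 * rtr A)) * t x); last first.
  apply/funext => x; rewrite /divf.
  under eq_bigr do rewrite mul0r add0r mul1r.
  by rewrite divergence_constant /=; ring.
rewrite -/(Int _) IntD; last 2 first.
- by apply: is_polyM => //; exact: is_poly_cst.
- by apply: is_polyM => //; exact: is_poly_cst.
by rewrite !IntZ //; lra.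
Qed.

(** The divergence theorem for [W = A] and [f] the [l]-th coordinate. *)
Lemma moment_constant l :
  2 * r ^+ 2 * rtr (S l *m A) * V -
    Int (fun x => rtr (S l *m (comb x *m comb x *m A + A *m (comb x *m comb x)))) =
  (gamma + 2 * c2) * Int (fun x => tnth x l * a x) + 2 * c1 * rtr A * Int (fun x => tnth x l * t x).
Proof.
have pc := mxpoly_comb S.
have pa : is_poly a.
  by have [p _] := cpoly_trace (mxpolyM (mxpoly_cst A) pc); eexists; exact: p.
pose q x := rtr (S l *m (comb x *m comb x *m A + A *m (comb x *m comb x))).
have pq : is_poly q.
  have pcc := mxpolyM pc pc; have pA := mxpoly_cst A (R := R) (m := m).
  have [p _] := cpoly_trace (mxpolyM (mxpoly_cst (S l)) (mxpolyD (mxpolyM pcc pA) (mxpolyM pA pcc))).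
  by eexists; exact: p.
have D := divergence_ball hS onS r0 pW (cpoly_coord l) fieldE.
rewrite (_ : (fun x => _) = fun x => 2 * r ^+ 2 * rtr (S l *m A) + ((-1) * q x +
   (- (gamma + 2 * c2) * (tnth x l * a x) + (- (2 * c1 * rtr A)) * (tnth x l * t x)))) in D; last first.
  apply/funext => x; rewrite /divf big_split /= -mulr_sumr divergence_constant.
  rewrite (bigD1 l) //= eqxx mul1r big1 ?addr0 => [|b /negbTE bl]; last by rewrite bl mul0r.
  rewrite (_ : \tr _ = toC (2 * r ^+ 2 * rtr (S l *m A)) - \tr (S l *m (comb x *m comb x *m A + A *m (comb x *m comb x)))).
    by rewrite /q /rtr; case: (\tr (S l *m (_ + _))) => /= ? ?; ring.
  have -> : field S r (fun=> A) x = toC (2 * r ^+ 2) *: A -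
      (comb x *m comb x *m A + A *m (comb x *m comb x)).
    rewrite /field hA /gap mulmxBl mulmxBr mul_mx_scalar mul_scalar_mx addrACA -opprD.
    by rewrite -scalerDl -rmorphD; congr (toC _ *: A - _); ring.
  rewrite mulmxBr -scalemxAr mxtraceD mxtraceZ raddfN /= (trace_real2 (hS l) hA).
  by rewrite -rmorphM.
move: D; rewrite -/(Int _) IntD; last 2 first.
- exact: is_poly_cst.
- apply: is_polyD; first by apply: is_polyM => //; exact: is_poly_cst.
  by apply: is_polyD; apply: is_polyM; (try exact: is_poly_cst); exact: is_polyM.
rewrite IntD; last 2 first.
- by apply: is_polyM => //; exact: is_poly_cst.
- by apply: is_polyD; apply: is_polyM; (try exact: is_poly_cst); exact: is_polyM.
rewrite IntD; last 2 first.
- by apply: is_polyM; [exact: is_poly_cst|exact: is_polyM].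
- by apply: is_polyM; [exact: is_poly_cst|exact: is_polyM].
rewrite IntC !IntZ //; try exact: is_polyM.
by rewrite -/q; lra.
Qed.

End constant_field.

Section linear_field.
Variable k : 'I_m.
Let W (x : tup) := S k *m comb x.

Let pW : mxpoly W (fun b _ => S k *m S b).
Proof.
apply: mxpoly_eq (mxpolyM (mxpoly_cst (S k)) (mxpoly_comb S)) _ _ => // b x.
by rewrite mul0mx add0r.
Qed.

Let hW x : hadj (W x) = comb x *m S k.
Proof. by rewrite hadjM hadj_comb // hS. Qed.

Let fieldE x : field S r W x = \sum_b \tr (S b *m field S r W x) *: S b.
Proof.
apply/esym/(expansion completeS) => //.
by rewrite /field hW; apply: symm_anticomm3.
Qed.

(** The divergence theorem for [W = S_k T] and [f = 1]. *)
Lemma moment_linear : gamma * r ^+ 2 * tau k * V =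
  (2 * gamma + 2 * c2) * Int (u k) + 2 * c1 * Int (fun x => tnth x k * t x).
Proof.
have D := divergence_ball hS onS r0 pW (cpoly_cst 1) fieldE.
rewrite (_ : (fun x => _) = fun x => gamma * r ^+ 2 * tau k +
  (- (2 * gamma + 2 * c2) * u k x + (- (2 * c1)) * (tnth x k * t x))) in D; last first.
  apply/funext => x; rewrite /divf.
  under eq_bigr do rewrite mul0r add0r mul1r /dfield hW hadjM !hS.
  rewrite (div_linear completeS (symS k) (comb_symm x) (erefl (gap S r x))).
  rewrite trace_S trace_T trace_comb // trace_STT.
  rewrite (_ : _ - _ = toC (gamma * r ^+ 2 * tau k +
    (- (2 * gamma + 2 * c2) * u k x + (- (2 * c1)) * (tnth x k * t x)))) //.
  rewrite /gamma /g !(rmorphN, rmorphD, rmorphM, rmorph_nat) /=; ring.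
move: D; rewrite -/(Int _) IntD; last 2 first.
- exact: is_poly_cst.
- by apply: is_polyD; apply: is_polyM; (try exact: is_poly_cst); (try exact: is_polyM).
rewrite IntD; last 2 first.
- by apply: is_polyM; [exact: is_poly_cst|].
- by apply: is_polyM; [exact: is_poly_cst|exact: is_polyM].
rewrite IntC !IntZ //; try exact: is_polyM.
by lra.
Qed.

End linear_field.

Let hadj1 : hadj (1%:M : 'M[C]_n) = 1%:M.
Proof. by rewrite -(rmorph1 toC) hadj_scalar. Qed.

Let symm_id : csymm (1%:M : 'M[C]_n).
Proof. exact: symm1. Qed.

Let rtr1 : rtr (1%:M : 'M[C]_n) = n%:R.
Proof. by rewrite /rtr mxtrace1 -(rmorph_nat toC). Qed.

Let identity_sum : (1%:M : 'M[C]_n) = \sum_b toC (tau b) *: S b.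
Proof.
rewrite -[LHS](expansion completeS toC12 symm_id); apply: eq_bigr => b _.
by rewrite mulmx1 trace_S.
Qed.

(** The trace of the expansion of the identity matrix. *)
Lemma sum_trace_sqr : \sum_b rtr (S b) ^+ 2 = n%:R.
Proof.
apply: complexI; rewrite rmorph_nat -mxtrace1 identity_sum !raddf_sum.
by apply: eq_bigr => b _; rewrite /= mxtraceZ trace_S -rmorphM expr2.
Qed.

Let gamma_ge2 : 2 <= gamma.
Proof.
rewrite /gamma ler_peMr // -c12 /g lerD2r ler_peMr ?(ltW c1_gt0) //.
by rewrite ler1n.
Qed.

Let gamma_gt0 : 0 < gamma.
Proof. exact: lt_le_trans gamma_ge2. Qed.

Let delta_gt0 : 0 < (2 * gamma + 2 * c2) * gamma - 2 * c1.
Proof.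
by apply: discriminant_gt0 => //; rewrite -c12 lerDl.
Qed.

Let denom_gt0 : 0 < gamma + 2 * c2.
Proof. by rewrite ltr_wpDr // mulr_ge0. Qed.

Let alpha := (gamma + 2 * c2) * r ^+ 2 * V / ((2 * gamma + 2 * c2) * gamma - 2 * c1).

Let alpha_gt0 : 0 < alpha.
Proof.
by rewrite divr_gt0 // mulr_gt0 // mulr_gt0 // exprn_gt0.
Qed.

(** The field [2 Y] of the identity matrix. *)
Let moment_one l : r ^+ 2 * tau l * V - Int (u l) = gamma * Int (fun x => tnth x l * t x).
Proof.
have := moment_constant hadj1 symm_id l.
rewrite mulmx1 rtr1 -/(tau l).
under [X in _ - Int X]eq_fun do rewrite mulmx1 mul1mx -mulr2n -scaler_nat.
rewrite (_ : (fun x => _) = fun x => 2 * u l x); last first.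
  apply/funext => x; rewrite -scalemxAr /u /rtr mxtraceZ -(rmorph_nat toC) Re_mulC.
  by rewrite !mulmxA.
under [X in _ = (gamma + _) * Int X + _]eq_fun do rewrite mul1mx.
by rewrite IntZ // -/t /gamma /g; lra.
Qed.

(** Eliminating the moment of [tr (S_l T^2)] between [moment_one] and
    [moment_linear] leaves one linear equation. *)
Let trace_moment l : Int (fun x => tnth x l * t x) = alpha * tau l.
Proof.
have h1 := moment_one l; have h2 := moment_linear l.
set w := Int (fun x => tnth x l * t x) in h1 h2 *.
apply: (mulIf (negbT (gt_eqF delta_gt0))).
have -> : alpha * tau l * ((2 * gamma + 2 * c2) * gamma - 2 * c1) =
    (gamma + 2 * c2) * r ^+ 2 * V * tau l.
  by rewrite /alpha mulrAC divfK // gt_eqF.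
have E : Int (u l) = r ^+ 2 * tau l * V - gamma * w by lra.
by rewrite E in h2; lra.
Qed.

Let square_moment l : Int (u l) = (r ^+ 2 * V - gamma * alpha) * tau l.
Proof. by have := moment_one l; rewrite trace_moment; lra. Qed.

Let trace_mean : Int t = 0.
Proof.
have := mean_constant hadj1 symm_id; rewrite rtr1.
rewrite (_ : (fun x => _) = t) => [H|]; last by apply/funext => x; rewrite mul1mx.
have : 2 * gamma * Int t = 0 by rewrite -[RHS]H /gamma /g; ring.
by move/eqP; rewrite mulf_eq0 => /orP[|/eqP //]; rewrite gt_eqF // mulr_gt0.
Qed.

Let rtr_Sx k : (fun x => rtr (S k *m comb x)) = (fun x => tnth x k).
Proof. by apply/funext => x; rewrite /rtr trace_comb. Qed.

(** The field of [S_k] expresses the mean of [x_k] by that of [tr T], which the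
    field of the identity matrix shows to vanish. *)
Lemma first_moment k : \int[leb]_(x in ball) tnth x k = 0.
Proof.
have := mean_constant (hS k) (symS k); rewrite trace_mean mulr0 addr0 rtr_Sx.
by move/eqP; rewrite mulf_eq0 (gt_eqF denom_gt0) => /eqP.
Qed.

(** Expanding [T^2] in the basis reduces to the moments of [tr (S_b T^2)], which
    are proportional to [tr S_b]; so on average [T^2] acts as a scalar. *)
Let quadratic_moment k l :
  Int (fun x => rtr (S l *m (comb x *m comb x *m S k + S k *m (comb x *m comb x)))) =
  2 * (r ^+ 2 * V - gamma * alpha) * (k == l)%:R.
Proof.
pose phi (X : 'M[C]_n) := rtr (S l *m (X *m S k + S k *m X)).
have phi_sum (a : 'I_m -> R) : phi (\sum_b toC (a b) *: S b) = \sum_b a b * phi (S b).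
  rewrite /phi mulmx_suml mulmx_sumr -big_split mulmx_sumr /rtr [\tr (\sum_(_ <- _) _)]raddf_sum [LHS]raddf_sum.
  apply: eq_bigr => b _ /=.
  by rewrite -scalemxAl -scalemxAr -scalerDr -scalemxAr mxtraceZ Re_mulC.
have sqE x : comb x *m comb x = \sum_b toC (u b x) *: S b.
  rewrite -[LHS](expansion completeS toC12 (symm_sqr (comb_symm x))).
  by apply: eq_bigr => b _; rewrite mulmxA trace_STT.
rewrite (_ : (fun x => _) = fun x => \sum_b phi (S b) * u b x); last first.
  apply/funext => x; rewrite -/(phi _) sqE phi_sum.
  by apply: eq_bigr => b _; rewrite mulrC.
rewrite Int_sum => [|b]; last by apply: is_polyM => //; exact: is_poly_cst.
transitivity ((r ^+ 2 * V - gamma * alpha) * \sum_b tau b * phi (S b)).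
  rewrite mulr_sumr; apply: eq_bigr => b _.
  by rewrite IntZ // square_moment; ring.
rewrite -phi_sum -identity_sum /phi mul1mx mulmx1 mulmxDr /rtr mxtraceD onS.
rewrite -(rmorph_nat toC) -rmorphD /= eq_sym; ring.
Qed.

Theorem second_moment k l :
  (gamma + 2 * c2) * \int[leb]_(x in ball) (tnth x k * tnth x l) =
  alpha * (2 * gamma * (k == l)%:R - 2 * c1 * rtr (S k) * rtr (S l)).
Proof.
have := moment_constant (hS k) (symS k) l; rewrite quadratic_moment.
rewrite trace_moment /rtr onS -(rmorph_nat toC) /= -/(rtr (S k)) -/(rtr (S l)) -/(tau l) -/(tau k).
rewrite (_ : (fun x => _) = fun x => tnth x k * tnth x l); last first.
  by apply/funext => x; rewrite -[complex.Re _]/(rtr (S k *m comb x)) (congr1 (@^~ x) (rtr_Sx k)) mulrC.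
by rewrite -/(Int _) eq_sym; lra.
Qed.

(** [second_moment] divided by the volume, the means being zero. *)
Theorem Cov_opball : exists2 a : R, 0 < a &
  Cov ball = \matrix_(k, l)
    (a * (2 * (c1 * n%:R + c2)) * (k == l)%:R - a * c1 * rtr (S k) * rtr (S l)).
Proof.
exists (2 * alpha / ((gamma + 2 * c2) * V)).
  by rewrite divr_gt0 // mulr_gt0.
apply/matrixP => k l; rewrite !mxE /average !first_moment !mul0r subr0.
have -> : \int[leb]_(x in ball) (tnth x k * tnth x l) =
    alpha * (2 * gamma * (k == l)%:R - 2 * c1 * rtr (S k) * rtr (S l)) / (gamma + 2 * c2).
  by rewrite -second_moment mulrAC divff ?mul1r // gt_eqF.
rewrite -/V -/g -/gamma; field.
by rewrite !gt_eqF.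
Qed.

End moments.

(** * Rank one perturbations of a scalar matrix *)

Section rank_one.
Variables (R : realType) (m : nat) (tau : 'I_m -> R) (b e : R).
Let N := \sum_k tau k ^+ 2.
Let A : 'M[R]_m := \matrix_(k, l) (b * (k == l)%:R - e * tau k * tau l).

Let mulA (v : 'rV[R]_m) l : (v *m A) 0 l = b * v 0 l - e * (\sum_k v 0 k * tau k) * tau l.
Proof.
rewrite mxE (eq_bigr (fun k => b * v 0 k * (k == l)%:R - e * (v 0 k * tau k) * tau l)); last first.
  by move=> k _; rewrite mxE; ring.
rewrite sumrB; congr (_ - _); last by rewrite -mulr_suml -mulr_sumr.
rewrite (bigD1 l) //= eqxx mulr1 big1 ?addr0 // => k /negbTE ->.
by rewrite mulr0.
Qed.

(** If [v] is not orthogonal to [tau], pairing the eigenvector equation with [tau]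
    determines the eigenvalue. *)
Lemma rank_one_eigenvalue a : eigenvalue A a -> a = b \/ a = b - e * N.
Proof.
move=> /eigenvalueP[v vA v0].
have vE l : (b - a) * v 0 l = e * (\sum_k v 0 k * tau k) * tau l.
  by have := mulA v l; rewrite vA mxE; lra.
have [s0|s0] := eqVneq (\sum_k v 0 k * tau k) 0; [left|right].
  have /existsP[l vl] : [exists l, v 0 l != 0].
    apply: contraNT v0 => /existsPn H; apply/eqP/rowP => l; rewrite mxE.
    by apply/eqP; have := H l; rewrite negbK.
  apply/eqP; rewrite eq_sym -subr_eq0; have := vE l; rewrite s0 mulr0 mul0r => /eqP.
  by rewrite mulf_eq0 (negbTE vl) orbF.
have : (b - a) * (\sum_k v 0 k * tau k) = e * N * (\sum_k v 0 k * tau k).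
  rewrite mulr_sumr (eq_bigr (fun l => e * (\sum_k v 0 k * tau k) * tau l ^+ 2)); last first.
    by move=> l _; rewrite mulrA vE; ring.
  by rewrite -mulr_sumr -/N; ring.
by move/(mulIf s0); lra.
Qed.

Lemma rank_one_eigenvector : 0 < N -> eigenvalue A (b - e * N).
Proof.
move=> N0; apply/eigenvalueP; exists (\row_l tau l).
  apply/rowP => l; rewrite mulA !mxE.
  rewrite (eq_bigr (fun k => tau k ^+ 2)); last by move=> k _; rewrite mxE expr2.
  by rewrite -/N; ring.
apply: contraTneq N0 => t0; rewrite /N big1 ?ltxx // => k _.
by have /rowP/(_ k) := t0; rewrite !mxE => ->; rewrite expr0n.
Qed.

(** Only one of the two possible eigenvalues has to be attained, to make the
    spectrum nonempty: the bounds on its supremum and infimum do the rest. *)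
Lemma rank_one_condition_number : 0 < N -> 0 <= e -> 0 < b - e * N ->
  b <= 2 * (b - e * N) -> (condition_number A <= 2%:E)%E.
Proof.
move=> N0 e0 a0 ba; rewrite /condition_number.
set E := [set a | eigenvalue A a]; set lmin := inf E.
have E0 : E !=set0 by exists (b - e * N); exact: rank_one_eigenvector.
have eN : 0 <= e * N by apply: mulr_ge0 => //; exact: ltW.
have hmin : b - e * N <= lmin.
  by apply: lb_le_inf => // a /rank_one_eigenvalue[] ->; lra.
have hmax : sup E <= b.
  by apply: ge_sup => // a /rank_one_eigenvalue[] ->; lra.
rewrite ifT; last exact: lt_le_trans hmin.
rewrite lee_fin ler_pdivrMr; last exact: lt_le_trans hmin.
by lra.
Qed.
End rank_one.

(** * The orthonormal basis inside the complex matrices *)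

Section basis.
Variables (R : realType) (F : scalars) (n : nat).
Local Notation C := R[i].
Local Notation toC := (real_complex R).
Local Notation h := (toC (Num.sqrt 2)^-1).

Definition to_complex : scalar_field R F -> C :=
  match F with RealScalars => toC | ComplexScalars => id end.

(** The basis of self-adjoint matrices with complex entries in both cases; its
    last family is indexed by an empty type over the reals. *)
Definition cbasis (b : basis_index F n) : 'M[C]_n :=
  match b with
  | inl (inl k) => delta_mx k k
  | inl (inr p) => h *: (delta_mx (val p).1 (val p).2 + delta_mx (val p).2 (val p).1)
  | inr p => ('i%C * h) *: (delta_mx (val p).1 (val p).2 - delta_mx (val p).2 (val p).1)
  end.

(** The coefficients of the completeness relation. *)
Definition weight1 : R := if F is ComplexScalars then 1 else 1 / 2.
Definition weight2 : R := if F is ComplexScalars then 0 else 1 / 2.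

Lemma sqr_h : h * h = 2^-1.
Proof.
rewrite -rmorphM -expr2 exprVn sqr_sqrtr ?ler0n // -(rmorph_nat toC) -fmorphV //.
Qed.

Lemma hadj_scaleC p q (a : C) (A : 'M[C]_(p, q)) : hadj (a *: A) = conjc a *: hadj A.
Proof. by apply/matrixP => i j; rewrite !mxE rmorphM. Qed.

Lemma hadj_delta (k l : 'I_n) : hadj (delta_mx k l : 'M[C]_n) = delta_mx l k.
Proof. by rewrite /hadj map_delta_mx trmx_delta. Qed.

Lemma hadj_cbasis b : hadj (cbasis b) = cbasis b.
Proof.
case: b => [[k|p]|p] /=; first exact: hadj_delta.
  by rewrite hadjZ hadjD !hadj_delta addrC.
rewrite hadj_scaleC hadjD hadjN !hadj_delta (_ : conjc _ = - ('i%C * h)); last first.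
  by apply/eqP; rewrite eq_complex /=; apply/andP; split; apply/eqP; ring.
by rewrite scaleNr -scalerN opprB.
Qed.

Lemma symm_cbasis b : symm (toC weight2) (cbasis b).
Proof.
rewrite /symm /weight2; case: b => [[k|p]|[p pF]] /=.
- by rewrite trmx_delta.
- by rewrite linearZ linearD /= !trmx_delta addrC.
- by move: pF; case: F => /=; rewrite ?andbF // !scale0r.
Qed.

Lemma trace_delta (k l : 'I_n) (X : 'M[C]_n) : \tr (delta_mx k l *m X) = X l k.
Proof.
rewrite /mxtrace (bigD1 k) //= big1 => [|i /negbTE ik].
  rewrite addr0 mxE (bigD1 l) //= !mxE !eqxx mul1r big1 ?addr0 // => i /negbTE il.
  by rewrite !mxE il andbF mul0r.
by rewrite mxE big1 // => j _; rewrite mxE ik mul0r.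
Qed.

Let swap_neq (p q : 'I_n * 'I_n) : (p.1 < p.2)%N -> (q.1 < q.2)%N ->
  (p.1 == q.2) && (p.2 == q.1) = false.
Proof.
move=> p12 q12; apply/negP => /andP[/eqP e1 /eqP e2].
by move: q12; rewrite -e1 -e2 ltnNge ltnW.
Qed.

Let pair_bool (p q : 'I_n * 'I_n) : (p.1 < p.2)%N -> (q.1 < q.2)%N ->
  (((p.2 == q.1) && (p.1 == q.2) = false) * ((p.1 == q.2) && (p.2 == q.1) = false)) *
  (((p.2 == q.2) && (p.1 == q.1) = (p == q)) * ((p.1 == q.1) && (p.2 == q.2) = (p == q))).
Proof.
move=> p12 q12; have H := swap_neq p12 q12; split; split => //.
- by rewrite andbC.
- by rewrite andbC -xpair_eqE -!surjective_pairing.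
Qed.

Let diag_bool (p : 'I_n * 'I_n) k : (p.1 < p.2)%N ->
  (((k == p.1) && (k == p.2) = false) * ((k == p.2) && (k == p.1) = false)) *
  (((p.2 == k) && (p.1 == k) = false) * ((p.1 == k) && (p.2 == k) = false)).
Proof.
move=> p12; have H : (k == p.1) && (k == p.2) = false.
  by apply/negP => /andP[/eqP k1 /eqP k2]; move: p12; rewrite -k1 -k2 ltnn.
by split; split; rewrite ?[_ == k]eq_sym // andbC ?H // ![_ == k]eq_sym.
Qed.

(** Nine cases according to the kinds of the two basis elements.  Since the pairs
    are increasing, an entry of one off-diagonal element meets only the
    matching entry of the other. *)
Lemma cbasis_orthonormal a b : \tr (cbasis a *m cbasis b) = (a == b)%:R.
Proof.
have h2 : h * h + h * h = 1 by rewrite sqr_h; field.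
have i2 : 'i%C * 'i%C = -1 :> C by rewrite -expr2 sqr_i.
have lt1 (p : {p : 'I_n * 'I_n | (p.1 < p.2)%N}) : ((val p).1 < (val p).2)%N := valP p.
have lt2 (p : {p : 'I_n * 'I_n | (p.1 < p.2)%N && (if F is ComplexScalars then true else false)}) :
  ((val p).1 < (val p).2)%N by case/andP: (valP p).
case: a b => [[k|p]|p] [[l|q]|q] /=;
  rewrite -?scalemxAl ?mxtraceZ ?mulmxDl ?mulNmx ?mxtraceD ?raddfN /= ?trace_delta !mxE.
- by rewrite andbb.
- by rewrite !(diag_bool _ (lt1 q)) addr0 mulr0.
- by rewrite !(diag_bool _ (lt2 q)) subr0 mulr0.
- by rewrite !(diag_bool _ (lt1 p)) addr0 mulr0.
- rewrite !(pair_bool (lt1 p) (lt1 q)) add0r addr0 -mulrDr mulrA; change (inl (inr p) == inl (inr q)) with (val p == val q).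
  by rewrite -[in LHS]mulr2n mulrnAr -mulrnAl mulr2n h2 mul1r.
- by rewrite !(pair_bool (lt1 p) (lt2 q)); ring.
- by rewrite !(diag_bool _ (lt2 p)) subr0 mulr0.
- by rewrite !(pair_bool (lt2 p) (lt1 q)); ring.
- rewrite !(pair_bool (lt2 p) (lt2 q)) sub0r subr0; change (inr p == inr q) with (val p == val q).
  transitivity ((- ('i%C * 'i%C)) * (h * h + h * h) * (val p == val q)%:R : C); first by ring.
  by rewrite i2 h2 opprK !mul1r.
Qed.

Lemma sum_lt_pairs (i p q j : 'I_n) :
  \sum_(k : 'I_n * 'I_n | (k.1 < k.2)%N)
    ((i == k.1) && (p == k.2))%:R * ((q == k.1) && (j == k.2))%:R =
  ((i < p)%N && ((i == q) && (p == j)))%:R :> C.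
Proof.
have [ip|ip] := ltnP i p; last first.
  rewrite big1 // => -[k l] /= kl; case: eqP => [ik|_]; last by rewrite mul0r.
  by case: eqP => [pl|_]; rewrite ?mul0r //; subst; rewrite ltnNge ip in kl.
rewrite (bigD1 (i, p)) //= !eqxx mul1r big1 ?addr0.
  by rewrite (eq_sym q) (eq_sym j).
move=> [k l] /andP[_]; rewrite xpair_eqE => /negbTE H.
by rewrite (eq_sym i) (eq_sym p) H mul0r.
Qed.

(** Write [X = [i = q][p = j]] and [Z = [i = j][p = q]].  The diagonal elements
    contribute [[i = p] X = [i = p] Z], the symmetric ones
    [[i != p] (X + Z) / 2] and the antisymmetric ones [[i != p] (Z - X) / 2]. *)
Lemma cbasis_complete (i p q j : 'I_n) :
  \sum_(b : basis_index F n) cbasis b i p * cbasis b q j =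
  toC weight1 * ((i == j) && (p == q))%:R + toC weight2 * ((i == q) && (p == j))%:R.
Proof.
have i2 : 'i%C * 'i%C = -1 :> C by rewrite -expr2 sqr_i.
pose A (a b c d : 'I_n) : C := ((a < b)%N && ((a == c) && (b == d)))%:R.
rewrite !big_sumType /=.
have -> : \sum_k (delta_mx k k : 'M[C]_n) i p * (delta_mx k k : 'M[C]_n) q j =
    ((i == p) && ((i == j) && (p == q)))%:R.
  rewrite (bigD1 i) //= big1 => [|k /negbTE ki]; last by rewrite !mxE (eq_sym i) ki mul0r.
  rewrite !mxE eqxx addr0 /= -natrM mulnb; congr (_%:R); congr (nat_of_bool _).
  by case: (eqVneq p i) => [->|/negbTE pi] /=; rewrite ?eqxx ?pi //= ?(eq_sym i) ?pi // andbC (eq_sym q).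
have sumE (P : pred ('I_n * 'I_n)) (f : 'I_n * 'I_n -> C) :
    \sum_(x : {x | P x}) f (val x) = \sum_(x | P x) f x by rewrite -big_sub.
have -> : \sum_(x : {p : 'I_n * 'I_n | (p.1 < p.2)%N})
   (h *: (delta_mx (val x).1 (val x).2 + delta_mx (val x).2 (val x).1 : 'M[C]_n)) i p *
   (h *: (delta_mx (val x).1 (val x).2 + delta_mx (val x).2 (val x).1 : 'M[C]_n)) q j =
   2^-1 * (A i p q j + A i p j q + (A p i q j + A p i j q)).
  rewrite (sumE _ (fun k => (h *: (delta_mx k.1 k.2 + delta_mx k.2 k.1 : 'M[C]_n)) i p *
    (h *: (delta_mx k.1 k.2 + delta_mx k.2 k.1 : 'M[C]_n)) q j)).
  rewrite /A -!sum_lt_pairs -!big_split mulr_sumr /=; apply: eq_bigr => k _.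
  by rewrite !mxE -sqr_h ![(_ == k.2) && _]andbC; ring.
have -> : \sum_(x : {p : 'I_n * 'I_n | (p.1 < p.2)%N && (if F is ComplexScalars then true else false)})
   (('i%C * h) *: (delta_mx (val x).1 (val x).2 - delta_mx (val x).2 (val x).1 : 'M[C]_n)) i p *
   (('i%C * h) *: (delta_mx (val x).1 (val x).2 - delta_mx (val x).2 (val x).1 : 'M[C]_n)) q j =
   if F is ComplexScalars then - 2^-1 * (A i p q j - A i p j q - (A p i q j - A p i j q)) else 0.
  rewrite (sumE _ (fun k => (('i%C * h) *: (delta_mx k.1 k.2 - delta_mx k.2 k.1 : 'M[C]_n)) i p *
    (('i%C * h) *: (delta_mx k.1 k.2 - delta_mx k.2 k.1 : 'M[C]_n)) q j)).
  case: F; first by rewrite big1 // => k; rewrite andbF.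
  rewrite (eq_bigl (fun k : 'I_n * 'I_n => (k.1 < k.2)%N)); last by move=> k; rewrite andbT.
  rewrite /A -!sum_lt_pairs -!sumrB mulr_sumr /=; apply: eq_bigr => k _.
  rewrite !mxE ![(_ == k.2) && _]andbC.
  transitivity (('i%C * 'i%C) * (h * h) * (((i == k.1) && (p == k.2))%:R - ((p == k.1) && (i == k.2))%:R)
     * (((q == k.1) && (j == k.2))%:R - ((j == k.1) && (q == k.2))%:R) : C); first by ring.
  by rewrite i2 sqr_h; ring.
have AE a b c d : A a b c d = (a < b)%:R * ((a == c) && (b == d))%:R :> C.
  by rewrite /A -natrM mulnb.
rewrite !AE.
have half : toC (1 / 2) = 2^-1 by rewrite mul1r -(rmorph_nat toC) fmorphV.
(* Trichotomy and the coincidence of [x] and [y] on the diagonal leave a field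
   identity. *)
have tri : (i < p)%:R + (p < i)%:R + (i == p)%:R = 1 :> C.
  rewrite -!natrD -[RHS]/(1%:R); congr (_%:R).
  by rewrite -(inj_eq val_inj) /=; case: (ltngtP i p).
have diagE : (i == p)%:R * ((i == j) && (p == q))%:R = (i == p)%:R * ((i == q) && (p == j))%:R :> C.
  by case: (eqVneq i p) => [->|_]; rewrite ?mul0r // andbC.
rewrite -mulnb natrM [(p == q) && (i == j)]andbC [(p == j) && (i == q)]andbC.
set x : C := ((i == j) && (p == q))%:R in diagE *; set y : C := ((i == q) && (p == j))%:R in diagE *.
have e3 : (p < i)%:R = 1 - (i < p)%:R - (i == p)%:R :> C by rewrite -[X in _ = X - _ - _]tri; ring.
rewrite e3 /weight1 /weight2; case: F => /=.
  rewrite half.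
  transitivity (2^-1 * (x + y) + 2^-1 * ((i == p)%:R * x - (i == p)%:R * y)); first by field.
  by rewrite diagE; ring.
rewrite rmorph1 rmorph0.
transitivity (x + 0 * y); last by ring.
by field.
Qed.

End basis.

(** * The ball of self-adjoint matrices in coordinates *)

Section identification.
Variable R : realType.
Local Notation C := R[i].
Local Notation toC := (real_complex R).

Definition ebasis F n (k : 'I_(dim_E F n)) : 'M[C]_n := cbasis R (enum_val k).

Local Notation cmx T := (map_mx (@to_complex R _) T).

Lemma cmx_basis F n (b : basis_index F n) : cmx (basis_E R b) = cbasis R b.
Proof.
case: F b => -[[k|[[k l] /= p]]|[[k l] /= p]] /=; rewrite ?map_mx_id ?map_delta_mx //.
- by rewrite map_mxZ map_mxD !map_delta_mx.
- by move: (p); rewrite andbF.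
Qed.

Lemma cmx_of_coords F n x : cmx (@of_coords R F n x) = comb (@ebasis F n) x.
Proof.
rewrite /comb (reindex (@enum_rank _)) /=; last exact/onW_bij/enum_rank_bij.
rewrite (eq_bigr (fun b => toC (tnth x (enum_rank b)) *: cmx (basis_E R b))); last first.
  by move=> b _; rewrite /ebasis enum_rankK cmx_basis.
case: F x => x; rewrite /of_coords.
  by rewrite map_mx_sum; apply: eq_bigr => b _; rewrite map_mxZ.
by rewrite map_mx_id //; apply: eq_bigr => b _; rewrite map_mx_id.
Qed.

Lemma cmx_adjoint F n (T : 'M[scalar_field R F]_n) : cmx (adjoint T) = hadj (cmx T).
Proof.
case: F T => T; apply/matrixP => i j; rewrite !mxE //.
by rewrite conjc_real.
Qed.

Lemma cmx_inj F n : injective (fun T : 'M[scalar_field R F]_n => cmx T).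
Proof.
case: F => T U /matrixP H; apply/matrixP => i j; have := H i j; rewrite !mxE //.
exact: complexI.
Qed.

Lemma cmxZ F n (c : R) (T : 'M[scalar_field R F]_n) :
  cmx (of_real F c *: T) = toC c *: cmx T.
Proof. by case: F T => T; rewrite ?map_mx_id // map_mxZ. Qed.

Lemma selfadjointE F n (T : 'M[scalar_field R F]_n) :
  selfadjoint T <-> hadj (cmx T) = cmx T.
Proof.
rewrite /selfadjoint /= -cmx_adjoint; split=> [->//|]; exact: cmx_inj.
Qed.

Lemma eigenvalue_cmx F n (T : 'M[scalar_field R F]_n) (s : R) :
  eigenvalue (T *m adjoint T) (of_real F s) = eigenvalue (cmx T *m hadj (cmx T)) (toC s).
Proof.
rewrite -cmx_adjoint; case: F T => T; last by rewrite !map_mx_id.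
by rewrite -map_mxM eigenvalue_map.
Qed.

(** The singular values are the absolute values of the eigenvalues.  They form a
    bounded set, so its supremum is an upper bound; if the set is empty the
    supremum is [0]. *)
Lemma s_max_contr F n (T : 'M[scalar_field R F]_n) : selfadjoint T ->
  s_max T <= 1 <-> contr 1 (cmx T).
Proof.
move=> /selfadjointE hT; have [P [l [PP PP' SE]]] := hermitian_spectral hT.
have sv_bound (L : R) : (forall j, l 0 j ^+ 2 <= L) -> forall s, singular_values T s -> s ^+ 2 <= L.
  move=> lL s [s0]; rewrite eigenvalue_cmx hT => /eigenvalueP[v vT v0].
  have /(bound_spectral PP PP' SE)/(_ v) := lL.
  have -> : nsq (v *m cmx T) = s ^+ 2 * nsq v.
    apply: complexI; rewrite -nsqE hadjM hT mulmxA -(mulmxA v) vT -scalemxAl mxE nsqE.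
    by rewrite -rmorphM.
  by rewrite ler_pM2r // lt_neqAle nsq_ge0 andbT eq_sym nsq_eq0.
have sv_l j : singular_values T `|l 0 j|.
  split; first exact: normr_ge0.
  rewrite eigenvalue_cmx hT real_normK ?num_real //; apply/eigenvalueP.
  exists (delta_mx 0 j *m P); last first.
    apply/negP => /eqP H; have := nsq_unitary PP (delta_mx 0 j : 'rV[C]_n).
    rewrite H; have -> : nsq (0 : 'rV[C]_n) = 0 by apply/eqP; rewrite nsq_eq0.
    move/esym/eqP; rewrite nsq_eq0 => /eqP/rowP/(_ j); rewrite !mxE !eqxx /=.
    by move/eqP; rewrite oner_eq0.
  rewrite SE conj_diagM // !mulmxA -(mulmxA _ P) PP mulmx1 scalemxAl; congr (_ *m P).
  apply/rowP => k; rewrite mul_mx_diag !mxE /=.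
  by have [->|_] := eqVneq k j; rewrite ?mul0r ?mulr0 // mul1r mulr1 expr2.
have sv_ub : has_ubound (singular_values T).
  exists (1 + \sum_j l 0 j ^+ 2) => s Hs.
  have s2 : s ^+ 2 <= \sum_j l 0 j ^+ 2.
    apply: sv_bound Hs => j; rewrite (bigD1 j) //= lerDl.
    by apply: sumr_ge0 => i _; rewrite sqr_ge0.
  by have := sqr_ge0 (s - 1); nra.
split=> [H|H].
  apply/(contr_spectral PP PP' SE) => j; rewrite -real_normK ?num_real //.
  rewrite lerXn2r ?nnegrE //; apply: le_trans H; exact: ub_le_sup.
have [E|/set0P E] := eqVneq (singular_values T) set0.
  by rewrite /s_max E sup0.
apply: ge_sup => // s Hs; have s0 : 0 <= s by case: Hs.
have : s ^+ 2 <= 1.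
  have /(contr_spectral PP PP' SE) lH := H.
  by apply: sv_bound Hs => j; have := lH j; rewrite expr1n.
by rewrite expr_le1.
Qed.

Lemma contr_scale n (c : R) (S : 'M[C]_n) : 0 < c -> contr 1 S -> contr c (toC c *: S).
Proof.
move=> c0 H v; rewrite -scalemxAr nsqZ ler_pM2l ?exprn_gt0 //.
by have := H v; rewrite expr1n mul1r.
Qed.

Lemma contr_unscale n (c : R) (S : 'M[C]_n) : 0 < c -> contr c S -> contr 1 (toC c^-1 *: S).
Proof.
move=> c0 H v; rewrite -scalemxAr nsqZ expr1n mul1r exprVn mulrC ler_pdivrMr ?exprn_gt0 //.
by rewrite mulrC; exact: H.
Qed.

Section body.
Variables (F : scalars) (n : nat).
Local Notation S := (@ebasis F n).

Lemma hadj_ebasis k : hadj (S k) = S k.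
Proof. exact: hadj_cbasis. Qed.

Lemma ebasis_orthonormal a b : \tr (S a *m S b) = (a == b)%:R.
Proof. by rewrite cbasis_orthonormal (inj_eq enum_val_inj). Qed.

Lemma ebasis_complete (i p q j : 'I_n) : \sum_b S b i p * S b q j =
  toC (weight1 R F) * ((i == j) && (p == q))%:R + toC (weight2 R F) * ((i == q) && (p == j))%:R.
Proof.
rewrite -cbasis_complete (reindex (@enum_rank _)) /=; last exact/onW_bij/enum_rank_bij.
by apply: eq_bigr => b _; rewrite /ebasis enum_rankK.
Qed.

Lemma selfadjoint_of_coords x : selfadjoint (@of_coords R F n x).
Proof.
by apply/selfadjointE; rewrite cmx_of_coords hadj_comb // => b; exact: hadj_ebasis.
Qed.

Lemma of_coords_ball : @of_coords R F n @^-1` ball_E R F n = opball S 1.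
Proof.
apply/seteqP; split => x /=.
  by move=> [sa]; rewrite s_max_contr // cmx_of_coords.
move=> H; split; first exact: selfadjoint_of_coords.
by rewrite s_max_contr ?cmx_of_coords //; exact: selfadjoint_of_coords.
Qed.

Definition unit_radius : R := (volume_E (ball_E R F n) `^ (dim_E F n)%:R^-1)^-1.

Lemma unit_radius_gt0 : 0 < unit_radius.
Proof.
rewrite invr_gt0 powR_gt0 // /volume_E of_coords_ball.
exact: volume_opball_gt0 hadj_ebasis ebasis_orthonormal _ _.
Qed.

(** The body of volume one is a ball of the operator norm; the value of its radius
    does not matter, only that it is positive. *)
Lemma of_coords_unit_ball :
  @of_coords R F n @^-1` unit_volume_ball_E R F n = opball S unit_radius.
Proof.
have c0 := unit_radius_gt0; apply/seteqP; split => x /=.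
  move=> [T [sa sT] E]; rewrite /opball /= -cmx_of_coords -E cmxZ.
  by apply: contr_scale => //; apply/s_max_contr.
move=> H; exists (of_real F unit_radius^-1 *: of_coords x).
  have sa : selfadjoint (of_real F unit_radius^-1 *: of_coords x).
    apply/selfadjointE; rewrite cmxZ hadjZ; congr (_ *: _).
    by apply/selfadjointE; exact: selfadjoint_of_coords.
  split => //; apply/s_max_contr => //; rewrite cmxZ cmx_of_coords.
  exact: contr_unscale.
apply: cmx_inj; rewrite !cmxZ scalerA -rmorphM divff ?gt_eqF //.
by rewrite rmorph1 scale1r.
Qed.

End body.
End identification.

(** * Covariance of the unit volume ball *)

Lemma weight1_gt0 (R : realType) F : 0 < weight1 R F.
Proof. by case: F; rewrite /weight1; lra. Qed.

Lemma weight2_ge0 (R : realType) F : 0 <= weight2 R F.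
Proof. by case: F; rewrite /weight2; lra. Qed.

Lemma weight_sum (R : realType) F : weight1 R F + weight2 R F = 1.
Proof. by case: F; rewrite /weight1 /weight2; lra. Qed.

Lemma rtr_diag (R : realType) F n (k : 'I_n) :
  rtr (@ebasis R F n (enum_rank (inl (inl k) : basis_index F n))) = 1.
Proof.
rewrite /rtr /ebasis enum_rankK /= /mxtrace (bigD1 k) //= big1 => [|i ik].
  by rewrite mxE !eqxx addr0.
by rewrite mxE (negbTE ik).
Qed.

Theorem mainTheorem3 (R : realType) :
  exists C : R, forall (F : scalars) (n : nat), (2 <= n)%N ->
    (~ exists c : R, Cov_E (unit_volume_ball_E R F n) = c%:M) /\
    (condition_number (Cov_E (unit_volume_ball_E R F n)) <= C%:E)%E.
Proof.
exists 2 => F n n2; have n0 : (0 < n)%N by exact: ltn_trans n2.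
have c1_gt0 : 0 < weight1 R F by exact: weight1_gt0.
have c2_ge0 : 0 <= weight2 R F by exact: weight2_ge0.
have c12 : weight1 R F + weight2 R F = 1 by exact: weight_sum.
have symmS k : symm (real_complex R (weight2 R F)) (@ebasis R F n k).
  exact: symm_cbasis.
have hS := @hadj_ebasis R F n; have onS := @ebasis_orthonormal R F n.
have cS := @ebasis_complete R F n.
rewrite /Cov_E of_coords_unit_ball.
have [a a0 ->] := Cov_opball n0 (unit_radius_gt0 R F n) hS onS cS symmS c1_gt0 c2_ge0 c12.
have N : \sum_k rtr (@ebasis R F n k) ^+ 2 = n%:R.
  exact: sum_trace_sqr hS cS c12.
have nr0 : 0 < n%:R :> R by rewrite ltr0n.
split=> [[c /matrixP E]|].
  (* The entry at the positions of the first two diagonal matrix units. *)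
  pose k0 : 'I_n := Ordinal n0; pose k1 : 'I_n := Ordinal n2.
  have := E (enum_rank (inl (inl k0) : basis_index F n)) (enum_rank (inl (inl k1) : basis_index F n)).
  rewrite !mxE !rtr_diag (inj_eq enum_rank_inj) /= mulr0n !mulr1 mulr0 sub0r => /eqP.
  by rewrite oppr_eq0 mulf_eq0 !gt_eqF.
have h1 : 0 < a * weight1 R F by rewrite mulr_gt0.
have h2 : 0 <= a * weight2 R F by rewrite mulr_ge0 // ltW.
have h3 : 0 < a * weight1 R F * n%:R by rewrite mulr_gt0.
have := @rank_one_condition_number R _ (fun k => rtr (@ebasis R F n k))
  (a * (2 * (weight1 R F * n%:R + weight2 R F))) (a * weight1 R F).
by rewrite N; apply; lra.
Qed.
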